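(* Let $\Gamma=(G,\sigma)$ be a signed graph with $G=(V,E)$, $|V|=n$. Let $\mathcal G$ be the set of all subgraphs of $\Gamma$ and $|V_{\Gamma_0}|$ the number of vertices of $\Gamma_0\in\mathcal G$, and let $\mathcal C:=\max_{1\le i\le n}|\kappa_i/\mu_i|$. For every $p\ge1$ and $1\le k\le n$, $$\lambda_k^{(p)}\ \ge\ 2^{p-1}\max_{\substack{\Gamma_0\in\mathcal G\\ |V_{\Gamma_0}|\ge n-k+1}}\lambda_{|V_{\Gamma_0}|-n+k}(A^\mu_{-\Gamma_0})-\mathcal C\ =\ 2^{p-1}\max_{\substack{\Gamma_0\in\mathcal G\\ |V_{\Gamma_0}|=n}}\lambda_k(A^\mu_{-\Gamma_0})-\mathcal C.$$
   Context: $G=(V,E)$ is a finite undirected graph without self-loops, $V=\{1,\dots,n\}$. A signed graph $\Gamma=(G,\sigma)$ has signature $\sigma:E\to\{\pm1\}$, $\sigma_{ij}=\sigma(\{i,j\})$, edge weight $w:E\to(0,\infty)$, vertex measure $\mu:V\to(0,\infty)$, potential $\kappa:V\to\mathbb R$. A subgraph $\Gamma_0$ has vertex set $V_0\subset V$ and edge set $E_0\subset E$ of edges with both ends in $V_0$, with restricted $\sigma,w,\mu,\kappa$. $-\Gamma_0$ is $\Gamma_0$ with signature negated. $A_{\Gamma}$ has entries $\sigma_{ij}w_{ij}$ for $i\sim j$, $0$ otherwise; $A^\mu_\Gamma=\mathrm{diag}(\mu)^{-1}A_\Gamma$; eigenvalues ordered $\lambda_1\le\lambda_2\le\cdots$.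 For $p\ge1$ and nonzero $f$, $\mathcal R_p^\sigma(f)=\frac{\sum_{\{i,j\}\in E}w_{ij}|f(i)-\sigma_{ij}f(j)|^p+\sum_i\kappa_i|f(i)|^p}{\sum_i\mu_i|f(i)|^p}$; $\mathcal S_p=\{f:\sum_i\mu_i|f(i)|^p=1\}$; Krasnoselskii genus $\gamma(B)$ of closed symmetric $B\subset\mathbb R^n\setminus\{0\}$: least $k$ with an odd continuous map $B\to\mathbb R^k\setminus\{0\}$; $\mathcal F_k(\mathcal S_p)$ = closed symmetric $B\subset\mathcal S_p$ with $\gamma(B)\ge k$; $\lambda_k^{(p)}=\min_{B\in\mathcal F_k(\mathcal S_p)}\max_{f\in B}\mathcal R_p^\sigma(f)$. *)

(* Defs.v *)
From HB Require Import structures.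
From mathcomp Require Import all_boot all_order all_algebra.
From mathcomp Require Import all_classical all_reals all_analysis.
Set Implicit Arguments. Unset Strict Implicit. Unset Printing Implicit Defensive.
Import Order.TTheory GRing.Theory Num.Theory.
Import numFieldNormedType.Exports.
Local Open Scope classical_set_scope.
Local Open Scope ring_scope.

Section SignedGraph.
Variables (R : realType) (n : nat).

(* A signed graph on V = 'I_n : adjacency relation [adj], signature [sg],
   weight [w] (only their values on edges matter), vertex measure [mu],
   potential [kap]. *)
Definition signed_graph (adj : rel 'I_n) (sg w : 'I_n -> 'I_n -> R)
  (mu kap : 'I_n -> R) : Prop :=
  [/\ (forall i, ~~ adj i i),
      (forall i j, adj i j = adj j i),
      (forall i j, adj i j -> sg i j = sg j i /\ (sg i j = 1 \/ sg i j = -1)),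
      (forall i j, adj i j -> w i j = w j i /\ 0 < w i j)
    & (forall i, 0 < mu i)].

Definition subgraph (adj : rel 'I_n) (V0 : {set 'I_n}) (E0 : rel 'I_n) : Prop :=
  (forall i j, E0 i j = E0 j i) /\
  (forall i j, E0 i j -> adj i j && (i \in V0) && (j \in V0)).

Definition Amu_neg (sg w : 'I_n -> 'I_n -> R) (mu : 'I_n -> R)
  (V0 : {set 'I_n}) (E0 : rel 'I_n) : 'M[R]_(#|V0|) :=
  \matrix_(a, b)
    let i := enum_val a in let j := enum_val b in
    (mu i)^-1 * (if E0 i j then - sg i j * w i j else 0).

Definition rayleigh_p (adj : rel 'I_n) (sg w : 'I_n -> 'I_n -> R)
  (mu kap : 'I_n -> R) (p : R) (f : 'rV[R]_n) : R :=
  ((\sum_(i < n) \sum_(j < n | (i < j)%N && adj i j)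
      w i j * powR `|f ord0 i - sg i j * f ord0 j| p)
   + \sum_(i < n) kap i * powR `|f ord0 i| p)
  / (\sum_(i < n) mu i * powR `|f ord0 i| p).

Definition Sp (mu : 'I_n -> R) (p : R) : set 'rV[R]_n :=
  [set f | \sum_(i < n) mu i * powR `|f ord0 i| p = 1].

End SignedGraph.

Definition odd_map_to (R : realType) (n j : nat) (B : set 'rV[R]_n) : Prop :=
  exists g : 'rV[R]_n -> 'rV[R]_j,
    [/\ {within B, continuous g},
        (forall x, B x -> g (- x) = - g x)
      & (forall x, B x -> g x != 0)].

(* Krasnoselskii genus gamma(B) >= k, i.e. the least j admitting an odd
   continuous map B -> R^j\{0} is >= k (or no such j exists). *)
Definition genus_ge (R : realType) (n : nat) (B : set 'rV[R]_n) (k : nat) : Prop :=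
  forall j, (j < k)%N -> ~ odd_map_to j B.

Definition Fk (R : realType) (n : nat) (mu : 'I_n -> R) (p : R) (k : nat)
  : set (set 'rV[R]_n) :=
  [set B : set 'rV[R]_n | [/\ closed B, (forall x, B x -> B (- x)), B `<=` Sp mu p
             & genus_ge B k]].

(* lambda_k^{(p)} = min_{B in F_k} max_{f in B} R_p(f), written as inf/sup. *)
Definition lambda_p (R : realType) (n : nat) (adj : rel 'I_n)
  (sg w : 'I_n -> 'I_n -> R) (mu kap : 'I_n -> R) (p : R) (k : nat) : R :=
  inf [set sup (rayleigh_p adj sg w mu kap p @` B) | B in Fk mu p k].

(* The nondecreasingly sorted list of eigenvalues (roots of the characteristic
   polynomial, with multiplicity) of a real square matrix whose characteristic
   polynomial splits over R; [::] otherwise. *)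
Definition eigs (R : realType) (m : nat) (M : 'M[R]_m) : seq R :=
  match pselect (exists s : seq R, sorted <=%R s /\
                   char_poly M = \prod_(x <- s) ('X - x%:P)) with
  | left H => projT1 (cid H)
  | right _ => [::]
  end.

(* lambda_k(M), 1-indexed: lambda_1 <= lambda_2 <= ... *)
Definition eigval (R : realType) (m : nat) (M : 'M[R]_m) (k : nat) : R :=
  nth 0 (eigs M) k.-1.

(* Main.v *)
Require Import Defs.
From HB Require Import structures.
From mathcomp Require Import all_boot all_order all_algebra.
From mathcomp Require Import all_classical all_reals all_analysis.
From mathcomp Require Import complex ring.
Import Order.TTheory GRing.Theory Num.Theory.
Import numFieldNormedType.Exports.
Local Open Scope classical_set_scope.
Local Open Scope ring_scope.

Set Implicit Arguments.
Unset Strict Implicit.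
Unset Printing Implicit Defensive.

(** Substitute [g_i = sgn(f_i) |f_i|^(p/2)].  By AM-GM, [|a + b|^p] is at least
    [2^p] times the product of the signed (p/2)-th powers of [a] and [b], so
    [R_p(f)] is at least [2^(p-1)] times the Rayleigh quotient of
    [A^mu_{-Gamma_0}] at [g], minus [C], for every subgraph.  A set of genus at
    least [k] cannot be mapped oddly into [R^(k-1) \ {0}], so the vector of the
    first [k-1] eigencoordinates of [g] vanishes somewhere on it; there the
    quotient is at least [lambda_k].  Subgraphs with fewer vertices are reduced
    to spanning ones by Cauchy interlacing.

    The infimum defining [lambda_k^(p)] must not run over the empty family (it
    would be the junk value [0]), so one needs [gamma(S_p) >= k], which is the
    Borsuk-Ulam theorem.  It is proved here by mod 2 chains: for an odd map
    [h] into [R^j], let [s_i] be the sign of [h_i]; the cup product of the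
    cocycles [delta s_0, ..., delta s_(j-1)] takes the value 1 on every iterated
    barycentric subdivision of a [j]-dimensional hemisphere, hence some small simplex
    [v_0, ..., v_j] has [h_i] changing sign between [v_i] and [v_(i+1)] for all [i],
    and these simplices accumulate at a zero of [h]. *)

(** * Mod 2 chains and cup products of sign cocycles *)

Section Chains.
Variable V : eqType.
Implicit Types (c : seq V -> bool) (s : seq V) (H : seq (seq V)).

(* A list of lists of vertices is a mod 2 chain of ordered simplices, [[::]] being
   the augmentation; two chains are identified when [ev] agrees on all cochains. *)
Definition ev c H : bool := \big[addb/false]_(s <- H) c s.

Fixpoint bd s : seq (seq V) :=
  if s is v :: s' then s' :: [seq v :: t | t <- bd s'] else [::].

Definition bdc H : seq (seq V) := flatten [seq bd s | s <- H].

Lemma ev_nil c : ev c [::] = false. Proof. exact: big_nil. Qed.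

Lemma ev_cons c s H : ev c (s :: H) = c s (+) ev c H.
Proof. exact: big_cons. Qed.

Lemma ev_cat c H1 H2 : ev c (H1 ++ H2) = ev c H1 (+) ev c H2.
Proof. exact: big_cat. Qed.

Lemma ev_map c (F : seq V -> seq V) H : ev c (map F H) = ev (c \o F) H.
Proof. exact: big_map. Qed.

Lemma ev_flatten c (F : seq V -> seq (seq V)) H :
  ev c (flatten (map F H)) = ev (fun s => ev c (F s)) H.
Proof.
elim: H => [|s H IH] /=; first by rewrite !ev_nil.
by rewrite ev_cat ev_cons IH.
Qed.

Lemma ev_bdc c H : ev c (bdc H) = ev (fun s => ev c (bd s)) H.
Proof. exact: ev_flatten. Qed.

Lemma ev_bd_cons c v s :
  ev c (bd (v :: s)) = c s (+) ev (fun t => c (v :: t)) (bd s).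
Proof. by rewrite /= ev_cons ev_map. Qed.

Lemma ev_add c1 c2 H : ev (fun s => c1 s (+) c2 s) H = ev c1 H (+) ev c2 H.
Proof. exact: big_split. Qed.

Lemma ev0 H : ev (fun=> false) H = false.
Proof. exact: big1. Qed.

Lemma ev_andl b c H : ev (fun s => b && c s) H = b && ev c H.
Proof. by case: b => //=; rewrite ev0. Qed.

Lemma eq_ev c1 c2 H : c1 =1 c2 -> ev c1 H = ev c2 H.
Proof. by move=> e; apply: eq_bigr. Qed.

Lemma eq_in_ev c1 c2 H : {in H, c1 =1 c2} -> ev c1 H = ev c2 H.
Proof. by move=> e; apply: eq_big_seq. Qed.

(** The facet opposite the apex gives back [H]; the facets through the apex form the cone over the
    boundary of [H]. *)
Lemma ev_cone c v H :
  ev c (bdc [seq v :: t | t <- H]) = ev c H (+) ev (fun t => c (v :: t)) (bdc H).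
Proof.
rewrite !ev_bdc ev_map -ev_add; apply: eq_ev => t /=.
by rewrite ev_cons ev_map.
Qed.

Lemma ev_bdbd c s : ev c (bdc (bd s)) = false.
Proof.
elim: s c => [|v s IH] c /=; first by rewrite ev_nil.
rewrite -[bdc _]/(bd s ++ bdc [seq v :: t | t <- bd s]) ev_cat ev_cone.
by rewrite IH addbF addbb.
Qed.

Lemma bd_mem t s : t \in bd s -> (size t).+1 = size s /\ {subset t <= s}.
Proof.
elim: s t => [|v s IH] t //=; rewrite inE => /orP[/eqP->|/mapP[u /IH[<- us] ->]].
  by split=> // x xs; rewrite inE xs orbT.
by split=> //= x; rewrite !inE => /orP[->//|/us->]; rewrite orbT.
Qed.

(** * Barycentric subdivision of chains *)

Section Subdivision.
Variable bary : seq V -> V.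

(** [m] is meant to be the size of [s]; it makes the recursion through the facets structural. *)
Fixpoint sd m s : seq (seq V) :=
  if m is m'.+1 then
    [seq bary s :: t | t <- flatten [seq sd m' u | u <- bd s]]
  else [:: [::]].

Definition sdc m H : seq (seq V) := flatten [seq sd m s | s <- H].

Lemma ev_sdc m c H : ev c (sdc m H) = ev (fun s => ev c (sd m s)) H.
Proof. exact: ev_flatten. Qed.

(** The boundary of a cone is its base plus the cone over the boundary of the base. Here the latter
    vanishes: by induction the boundary of the base is a subdivision of the boundary of a
    boundary. *)
Lemma ev_sd_bd m c s : size s = m.+1 ->
  ev c (bdc (sd m.+1 s)) = ev c (sdc m (bd s)).
Proof.
elim: m c s => [|m IH] c s sz.
  by case: s sz => [|v []].
rewrite [sd _ _]/(map _ _) -/(sdc m.+1 (bd s)) ev_cone.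
set c' := fun t => c _; suff -> : ev c' (bdc (sdc m.+1 (bd s))) = false.
  by rewrite addbF.
rewrite ev_bdc ev_sdc.
rewrite (@eq_in_ev _ (fun u => ev (fun t => ev c' (sd m t)) (bd u))).
  by rewrite -(ev_bdc (fun t => ev c' (sd m t))) ev_bdbd.
move=> u /bd_mem[]; rewrite sz => -[su] _.
by transitivity (ev c' (bdc (sd m.+1 u))); [rewrite ev_bdc | rewrite IH // ev_sdc].
Qed.

Lemma ev_sdc_bd m c H : {in H, forall s, size s = m.+1} ->
  ev c (bdc (sdc m.+1 H)) = ev c (sdc m (bdc H)).
Proof.
move=> Hs; rewrite ev_bdc !ev_sdc ev_bdc; apply: eq_in_ev => s sH.
by transitivity (ev c (bdc (sd m.+1 s))); [rewrite ev_bdc | rewrite ev_sd_bd ?Hs // ev_sdc].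
Qed.

Lemma sdc_cat m H1 H2 : sdc m (H1 ++ H2) = sdc m H1 ++ sdc m H2.
Proof. by rewrite /sdc map_cat flatten_cat. Qed.

Lemma sdc_size m H : {in H, forall s, size s = m} ->
  {in sdc m H, forall s, size s = m}.
Proof.
elim: m H => [|m IH] H Hs t /flattenP[l /mapP[s sH ->]].
  by rewrite inE => /eqP->.
case/mapP => u uS ->; rewrite /= (IH (bd s)) // => v /bd_mem[].
by rewrite (Hs s) // => -[].
Qed.

Lemma sd_mem m s t : t \in sd m.+1 s ->
  exists s' t', [/\ s' \in bd s, t' \in sd m s' & t = bary s :: t'].
Proof.
by case/mapP => t' /flattenP[l /mapP[s' ? ->]] ? ->; exists s', t'.
Qed.

Lemma sdc_mem m H t : t \in sdc m H -> exists2 s, s \in H & t \in sd m s.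
Proof. by case/flattenP=> l /mapP[s ? ->]; exists s. Qed.

Lemma eq_ev_sdc m c H1 H2 :
  (forall c, ev c H1 = ev c H2) -> ev c (sdc m H1) = ev c (sdc m H2).
Proof. by move=> e; rewrite !ev_sdc e. Qed.

End Subdivision.

(** * Cup products of sign differences and the antipode *)

Section AlternatingCochain.
Variables (sg : nat -> V -> bool) (tau : V -> V).

(* [cupB i] is the cup product of the 1-cocycles [delta (sg i)],
   [delta (sg i.+1)], ...; [cupC i] is the same product with the last factor
   replaced by the 0-cochain [sg] itself, so that its coboundary is [cupB i]. *)
Fixpoint cupB i s : bool :=
  if s is v :: s1 then
    if s1 is u :: _ then (sg i v (+) sg i u) && cupB i.+1 s1 else true
  else true.

Fixpoint cupC i s : bool :=
  if s is v :: s1 then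
    if s1 is u :: _ then (sg i v (+) sg i u) && cupC i.+1 s1 else sg i v
  else false.

(** In the faces omitting [v] or [u] the leading factors add up to [sg i v (+) sg i u], which is
    also the leading factor of all other faces. What remains is the same identity for the tail. *)
Lemma cupC_bd i v u s :
  ev (cupC i) (bd (v :: u :: s)) = cupB i (v :: u :: s).
Proof.
elim: s i v u => [|t s IH] i v u.
  by rewrite /= !ev_cons ev_nil addbF andbT addbC.
rewrite ev_bd_cons -[bd (u :: _)]/((t :: s) :: map (cons u) (bd (t :: s))).
rewrite ev_cons ev_map.
rewrite (@eq_in_ev _ (fun x => (sg i v (+) sg i u) && cupC i.+1 (u :: x))); last first.
  by move=> x _.
rewrite ev_andl.
have -> : cupB i [:: v, u, t & s] =
    (sg i v (+) sg i u) && cupB i.+1 [:: u, t & s] by [].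
have E x : cupC i [:: x, t & s] = (sg i x (+) sg i t) && cupC i.+1 (t :: s) by [].
rewrite -IH [in RHS]ev_bd_cons !E.
set X := cupC i.+1 _; set Y := ev _ _.
by case: (sg i v); case: (sg i u); case: (sg i t); case: X; case: Y.
Qed.

(** [tau] preserves every difference of signs and flips only the last factor, so the change is the
    product of the differences. *)
Lemma cupC_tau i v s : {in v :: s, forall v j, sg j (tau v) = ~~ sg j v} ->
  cupC i (map tau (v :: s)) = cupC i (v :: s) (+) cupB i (v :: s).
Proof.
elim: s i v => [|u s IH] i v h; first by rewrite /= h ?inE // addbT.
have h' : {in u :: s, forall v j, sg j (tau v) = ~~ sg j v}.
  by move=> x xs; apply: h; rewrite inE xs orbT.
have -> : cupC i (map tau [:: v, u & s]) =
   (sg i (tau v) (+) sg i (tau u)) && cupC i.+1 (map tau (u :: s)) by [].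
rewrite IH // !h ?inE ?eqxx ?orbT // addbN addNb negbK.
by rewrite -andb_addr.
Qed.

End AlternatingCochain.

(* [sphere m] is the boundary of the cross-polytope on the vertices
   [e i, tau (e i)], i < m, and [hemi m] the half of [sphere m.+1] around [e m]. *)
Section AlternatingSimplex.
Variables (bary : seq V -> V) (tau : V -> V) (e : nat -> V).
Hypothesis tauK : involutive tau.
Hypothesis bary_tau : forall s, bary (map tau s) = tau (bary s).

Fixpoint sphere m : seq (seq V) :=
  if m is m'.+1 then
    [seq e m' :: t | t <- sphere m'] ++ [seq tau (e m') :: t | t <- sphere m']
  else [:: [::]].

Definition hemi m := [seq e m :: t | t <- sphere m].

Definition sdN N m H := iter N (sdc bary m) H.

Lemma sphere_size m : {in sphere m, forall s, size s = m}.
Proof.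
elim: m => [|m IH] s /=; first by rewrite inE => /eqP->.
by rewrite mem_cat => /orP[] /mapP[t /IH <- ->].
Qed.

Lemma ev_bdc_cat c H1 H2 :
  ev c (bdc (H1 ++ H2)) = ev c (bdc H1) (+) ev c (bdc H2).
Proof. by rewrite !ev_bdc ev_cat. Qed.

(** The sphere is two cones over a common base: the base cancels mod 2, and by induction it has no
    boundary. *)
Lemma ev_bd_sphere m c : ev c (bdc (sphere m)) = false.
Proof.
elim: m c => [|m IH] c; first exact: ev_nil.
by rewrite ev_bdc_cat !ev_cone !IH !addbF addbb.
Qed.

Lemma ev_bd_hemi m c : ev c (bdc (hemi m)) = ev c (sphere m).
Proof. by rewrite ev_cone ev_bd_sphere addbF. Qed.

Lemma ev_tau_sphere m c : ev c (map (map tau) (sphere m)) = ev c (sphere m).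
Proof.
elim: m c => [|m IH] c //=.
rewrite map_cat !ev_cat -!map_comp !ev_map addbC.
have E v : ev (c \o (map tau \o cons v)) (sphere m)
    = ev (c \o cons (tau v)) (sphere m).
  by rewrite -(IH (c \o cons (tau v))) ev_map.
by rewrite !E tauK.
Qed.

(** The second cone is the image of [hemi m] because the smaller sphere is, as a chain though not as
    a list, invariant under [tau]. *)
Lemma ev_sphereS m c :
  ev c (sphere m.+1) = ev c (hemi m) (+) ev c (map (map tau) (hemi m)).
Proof.
rewrite ev_cat; congr addb.
rewrite -map_comp !ev_map.
by rewrite -(ev_tau_sphere m (c \o cons (tau (e m)))) ev_map.
Qed.

Lemma bd_tau s : bd (map tau s) = map (map tau) (bd s).
Proof. by elim: s => [//|v s IH] /=; rewrite IH -!map_comp. Qed.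

Lemma sd_tau m s : sd bary m (map tau s) = map (map tau) (sd bary m s).
Proof.
elim: m s => [//|m IH] s /=.
rewrite bd_tau bary_tau -map_comp.
have /eq_map -> : sd bary m \o map tau =1 map (map tau) \o sd bary m by exact: IH.
by rewrite map_comp -map_flatten -!map_comp.
Qed.

Lemma ev_sdN_tau N m c H :
  ev c (sdN N m (map (map tau) H)) = ev c (map (map tau) (sdN N m H)).
Proof.
elim: N c => [//|N IH] c; rewrite /sdN !iterS -!/(sdN _ _ _).
rewrite ev_sdc IH !ev_map ev_sdc; apply: eq_ev => s /=.
by rewrite sd_tau ev_map.
Qed.

Lemma sdN_size N m H : {in H, forall s, size s = m} ->
  {in sdN N m H, forall s, size s = m}.
Proof. by move=> Hs; elim: N => [//|N IH]; apply: sdc_size. Qed.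

Lemma ev_sdN_bd N m c H : {in H, forall s, size s = m.+1} ->
  ev c (bdc (sdN N m.+1 H)) = ev c (sdN N m (bdc H)).
Proof.
move=> Hs; elim: N c => [//|N IH] c; rewrite /sdN !iterS -!/(sdN _ _ _).
rewrite ev_sdc_bd; last exact: sdN_size.
by apply: eq_ev_sdc => c'; exact: IH.
Qed.

Lemma eq_ev_sdN N m c H1 H2 :
  (forall c, ev c H1 = ev c H2) -> ev c (sdN N m H1) = ev c (sdN N m H2).
Proof.
by move=> h; elim: N c => [//|N IH] c; apply: eq_ev_sdc => c'; exact: IH.
Qed.

Lemma sdN_cat N m H1 H2 : sdN N m (H1 ++ H2) = sdN N m H1 ++ sdN N m H2.
Proof. by elim: N => [//|N IH]; rewrite /sdN !iterS -!/(sdN _ _ _) IH sdc_cat. Qed.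

Lemma hemi_size m : {in hemi m, forall s, size s = m.+1}.
Proof. by move=> s /mapP[t /sphere_size <- ->]. Qed.

(* [hemi d.+1] bounds [(1 + tau) (hemi d)], [cupB] is the coboundary of [cupC]
   and [cupC + tau cupC = cupB], so the value does not depend on [d]. *)
Lemma ev_cupB_hemi (sg : nat -> V -> bool) N d :
  (forall m s v j, (m < d)%N -> s \in sdN N m.+1 (hemi m) -> v \in s ->
    sg j (tau v) = ~~ sg j v) ->
  ev (cupB sg 0) (sdN N d.+1 (hemi d)).
Proof.
elim: d => [|d IH] h.
  (* [cupB] is 1 on a point, so the value is the parity of the number of points. This is the
     augmented boundary evaluated on the empty simplex, and subdivision preserves it. *)
  have -> : ev (cupB sg 0) (sdN N 1 (hemi 0)) =
      ev (fun s => s == [::]) (bdc (sdN N 1 (hemi 0))).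
    rewrite ev_bdc; apply: eq_in_ev => s /sdN_size sz.
    have {sz} := sz (@hemi_size _); case: s => [|v []] //= _.
    by rewrite ev_cons ev_nil.
  rewrite ev_sdN_bd; last exact: hemi_size.
  suff -> : sdN N 0 (bdc (hemi 0)) = [:: [::]] by rewrite ev_cons ev_nil.
  by elim: N {h} => [//|N IH]; rewrite /sdN iterS -/(sdN _ _ _) IH.
have -> : ev (cupB sg 0) (sdN N d.+2 (hemi d.+1)) =
    ev (cupC sg 0) (bdc (sdN N d.+2 (hemi d.+1))).
  rewrite ev_bdc; apply: eq_in_ev => s /sdN_size sz.
  have {sz} := sz (@hemi_size _); case: s => [|v [|u s]] // _.
  by rewrite cupC_bd.
rewrite ev_sdN_bd; last exact: hemi_size.
rewrite (eq_ev_sdN _ _ _ (H2 := hemi d ++ map (map tau) (hemi d))); last first.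
  by move=> c; rewrite ev_bd_hemi ev_sphereS ev_cat.
rewrite sdN_cat ev_cat ev_sdN_tau ev_map -ev_add.
rewrite (@eq_in_ev _ (cupB sg 0)); first by apply: IH => m s v j /ltnW; exact: h.
move=> s sH /=; have := sdN_size (@hemi_size d) sH.
case: s sH => [//|v s] sH _; rewrite cupC_tau ?addbA ?addbb // => x xs j.
by apply: (h d (v :: s)).
Qed.

Lemma alternating_simplex (sg : nat -> V -> bool) N d :
  (forall m s v j, (m < d)%N -> s \in sdN N m.+1 (hemi m) -> v \in s ->
    sg j (tau v) = ~~ sg j v) ->
  exists2 s, s \in sdN N d.+1 (hemi d) & cupB sg 0 s.
Proof.
move=> h; have := ev_cupB_hemi h; move: (sdN _ _ _) => H.
elim: H => [|s H IH]; first by rewrite ev_nil.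
rewrite ev_cons; case E: (cupB sg 0 s) => /=.
  by move=> _; exists s; rewrite ?inE ?eqxx.
by move/IH => [t tH ct]; exists t; rewrite // inE tH orbT.
Qed.

Lemma cupB_nth (sg : nat -> V -> bool) x0 i s j : cupB sg i s ->
  (j.+1 < size s)%N -> sg (i + j)%N (nth x0 s j) != sg (i + j)%N (nth x0 s j.+1).
Proof.
elim: s i j => [//|v [//|u s] IH] i j /andP[a b]; case: j => [|j] sz.
  by rewrite addn0 /=; case: (sg i v) a; case: (sg i u).
by rewrite addnS -addSn; exact: IH.
Qed.

End AlternatingSimplex.
End Chains.

(** * The Borsuk-Ulam theorem *)

Lemma continuous_sumr (R : realType) (T : topologicalType) (m : nat)
  (F : 'I_m -> T -> R) : (forall i, continuous (F i)) ->
  continuous (fun x => \sum_(i < m) F i x).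
Proof.
move=> h; apply: (@continuous_big R 'I_m +%R 0 xpredT) => //.
exact: add_continuous.
Qed.

Lemma entry_continuous (R : realType) (T : topologicalType) (m : nat)
  (h : T -> 'rV[R]_m) (k : 'I_m) (phi : R -> R) (a : R) (x : T) :
  {for x, continuous h} -> continuous phi ->
  {for x, continuous (fun y => a * phi (h y ord0 k))}.
Proof.
move=> hx phic; apply: cvgMl_tmp.
apply: (@continuous_comp T R R (fun y => h y ord0 k) phi); last exact: phic.
apply: (@continuous_comp _ _ _ h (fun y : 'rV_m => y ord0 k)) => //.
exact: coord_continuous.
Qed.

Section BorsukUlam.
Variables (R : realType) (n : nat).
Local Notation V := 'rV[R]_n.
Implicit Types (s t : seq V) (x v u : V).

Definition bary s : V := (size s)%:R^-1 *: \sum_(v <- s) v.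

Lemma baryN s : bary (map -%R s) = - bary s.
Proof. by rewrite /bary size_map big_map sumrN scalerN. Qed.

(** The part of convexity that subdivision uses. *)
Definition bary_closed (Q : V -> Prop) :=
  forall s, s != [::] -> (forall v, v \in s -> Q v) -> Q (bary s).

Lemma sd_bary_closed (Q : V -> Prop) m s t : bary_closed Q ->
  size s = m -> (forall v, v \in s -> Q v) -> t \in sd bary m s ->
  forall v, v \in t -> Q v.
Proof.
move=> Qb; elim: m s t => [|m IH] s t sz Qs.
  by rewrite inE => /eqP->.
case/sd_mem => s' [t' [s's t's' ->]] v.
have [sz' sub] := bd_mem s's.
rewrite inE => /orP[/eqP->|]; first by apply: Qb Qs; rewrite -size_eq0 sz.
apply: IH t's' v; first by move: sz'; rewrite sz => -[].
by move=> v /sub; exact: Qs.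
Qed.

Definition small (r : R) s := forall u v, u \in s -> v \in s -> `|u - v| <= r.

Lemma bary_ball (x : V) r : bary_closed (fun v => `|x - v| <= r).
Proof.
move=> s s0 h; have sz : 0 < (size s)%:R :> R by rewrite ltr0n lt0n size_eq0.
have -> : x - bary s = (size s)%:R^-1 *: \sum_(v <- s) (x - v).
  rewrite big_split /= sumrN big_const_seq count_predT iter_addr_0.
  by rewrite scalerDr scalerN -(scaler_nat _ x) scalerK ?gt_eqF.
rewrite normrZ ger0_norm ?invr_ge0 ?(ltW sz) // ler_pdivrMl // mulr_natl.
apply: (le_trans (ler_norm_sum _ _ _)).
rewrite -[leRHS](_ : \sum_(v <- s) r = _); last first.
  by rewrite big_const_seq count_predT iter_addr_0.
by rewrite big_seq [leRHS]big_seq; apply: ler_sum => v; exact: h.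
Qed.

(** [bary s - v] averages the differences [u - v], and the term [u = v] vanishes; this gives the
    factor [(size s - 1) / size s], at most [n / (n + 1)]. *)
Lemma dist_bary_vertex s v r : (size s <= n.+1)%N -> small r s -> v \in s ->
  `|bary s - v| <= n%:R / n.+1%:R * r.
Proof.
move=> szn sm vs.
have s0 : (0 < size s)%N by case: (s) vs.
have r0 : 0 <= r by rewrite (le_trans _ (sm _ _ vs vs)) // normr_ge0.
have sz : 0 < (size s)%:R :> R by rewrite ltr0n.
have -> : bary s - v = (size s)%:R^-1 *: \sum_(u <- rem v s) (u - v).
  have -> : \sum_(u <- rem v s) (u - v) = \sum_(u <- s) (u - v).
    by rewrite (perm_big _ (perm_to_rem vs)) /= big_cons subrr add0r.
  rewrite big_split /= big_const_seq count_predT iter_addr_0.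
  by rewrite mulNrn scalerDr scalerN -(scaler_nat _ v) scalerK ?gt_eqF.
rewrite normrZ ger0_norm ?invr_ge0 ?(ltW sz) //.
apply: (@le_trans _ _ ((size s)%:R^-1 * ((size s).-1%:R * r))).
  rewrite ler_pM2l ?invr_gt0 //; apply: (le_trans (ler_norm_sum _ _ _)).
  have -> : (size s).-1%:R * r = \sum_(u <- rem v s) r.
    by rewrite big_const_seq count_predT iter_addr_0 size_rem // mulr_natl.
  rewrite big_seq [leRHS]big_seq; apply: ler_sum => u /mem_rem us.
  exact: sm.
rewrite mulrA ler_wpM2r // mulrC ler_pdivrMr // mulrAC ler_pdivlMr ?ltr0n //.
rewrite -!natrM ler_nat mulnS; case: (size s) s0 szn => //= k _.
by rewrite ltnS mulnSr mulnC => kn; rewrite [leqRHS]addnC leq_add.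
Qed.

(** Apart from [bary s], the vertices of [t] come from a subdivided facet. The facet's own vertices
    lie in the ball of reduced radius around [bary s], so by convexity those of its subdivision do
    too; distances within the facet follow by induction. *)
Lemma sd_small m s t r : size s = m -> (m <= n.+1)%N -> small r s ->
  t \in sd bary m s -> small (n%:R / n.+1%:R * r) t.
Proof.
elim: m s t => [|m IH] s t sz mn sm; first by rewrite inE => /eqP-> u v.
case/sd_mem => s' [t' [s's t's' ->]].
have [sz' sub] := bd_mem s's.
have sz's : size s' = m by move: sz'; rewrite sz => -[].
have st : forall v, v \in t' -> `|bary s - v| <= n%:R / n.+1%:R * r.
  apply: (sd_bary_closed (@bary_ball _ _) sz's _ t's') => v /sub vs.
  by apply: dist_bary_vertex => //; rewrite sz.
have s't' : small (n%:R / n.+1%:R * r) t'.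
  by apply: (IH s') => //; [exact: ltnW|move=> u v /sub us /sub; exact: sm].
have r0 : 0 <= n%:R / n.+1%:R * r.
  case: (s) sz sm => // v s0 _ /(_ v v); rewrite mem_head => /(_ isT isT) h.
  by rewrite mulr_ge0 ?divr_ge0 // (le_trans _ h).
move=> u v; rewrite !inE => /orP[/eqP->|ut] /orP[/eqP->|vt]; last exact: s't'.
- by rewrite subrr normr0.
- exact: st.
- by rewrite distrC; exact: st.
Qed.

Lemma sdN_small m N H t r : (m <= n.+1)%N ->
  (forall s, s \in H -> size s = m) -> (forall s, s \in H -> small r s) ->
  t \in sdN bary N m H -> small ((n%:R / n.+1%:R) ^+ N * r) t.
Proof.
move=> mn sz sm; elim: N t => [|N IH] t; first by rewrite expr0 mul1r; exact: sm.
rewrite /sdN iterS => /sdc_mem[s sH ts]; rewrite exprS -mulrA.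
by apply: sd_small ts => //; [exact: sdN_size sH|exact: IH].
Qed.

(** A simplex of the iterated subdivision stays in the convex hull of one simplex of [H];
    quantifying over [Q] expresses this without hulls. *)
Lemma sdN_bary_closed (m N : nat) H t : (forall s, s \in H -> size s = m) ->
  t \in sdN bary N m H -> exists2 s, s \in H &
  forall Q : V -> Prop, bary_closed Q -> (forall v, v \in s -> Q v) ->
  forall v, v \in t -> Q v.
Proof.
move=> sz; elim: N t => [|N IH] t; first by exists t.
rewrite /sdN iterS => /sdc_mem[s sH ts]; have [s' s'H h] := IH _ sH.
exists s' => // Q Qb Qs'; apply: (sd_bary_closed Qb _ _ ts).
  exact: sdN_size sH.
exact: h.
Qed.

Definition unit_row (i : nat) : V := \row_j (j == i :> nat)%:R.

(** No simplex contains two antipodal vertices, so [b] names a closed orthant containing it. *)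
Lemma sphere_signs m s : s \in sphere -%R unit_row m ->
  exists b : nat -> bool, forall v, v \in s ->
  exists2 i, (i < m)%N & v = (-1) ^+ b i *: unit_row i.
Proof.
elim: m s => [|m IH] s; first by rewrite inE => /eqP->; exists xpredT.
rewrite [sphere _ _ _]/(_ ++ _) mem_cat => sm.
have [c [t tm ->]] : exists c : bool, exists2 t, t \in sphere -%R unit_row m &
    s = ((-1) ^+ c *: unit_row m) :: t.
  case/orP: sm => /mapP[t tm ->]; [exists false|exists true]; exists t => //.
    by rewrite scale1r.
  by rewrite scaleN1r.
have [b hb] := IH _ tm; exists (fun i => if i == m then c else b i) => v.
rewrite inE => /orP[/eqP->|/hb[i im ->]]; first by exists m; rewrite ?eqxx.
by exists i; rewrite ?(ltn_eqF im) // ltnW.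
Qed.

Definition norm1 x : R := \sum_(i < n) `|x ord0 i|.

(** On the closed orthant given by [b], [norm1] is linear, so barycentres of points of norm 1 there
    again have norm 1. *)
Lemma hemi_norm1 d N t : (d < n)%N ->
  t \in sdN bary N d.+1 (hemi -%R unit_row d) ->
  forall v, v \in t -> norm1 v = 1.
Proof.
move=> dn /sdN_bary_closed[|s sH h]; first exact: hemi_size.
have [b hb] : exists b : nat -> bool, forall v, v \in s ->
    exists2 i, (i < d.+1)%N & v = (-1) ^+ b i *: unit_row i.
  by apply: sphere_signs; rewrite mem_cat sH.
pose Q (x : V) := (forall j : 'I_n, 0 <= (-1) ^+ b j * x ord0 j) /\
  \sum_(j < n) (-1) ^+ b j * x ord0 j = 1.
have Qb : bary_closed Q.
  move=> u u0 hu; have sz : 0 < (size u)%:R :> R by rewrite ltr0n lt0n size_eq0.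
  have E (j : 'I_n) : (-1) ^+ b j * bary u ord0 j
      = (size u)%:R^-1 * \sum_(v <- u) (-1) ^+ b j * v ord0 j.
    by rewrite mxE summxE mulrCA mulr_sumr.
  split=> [j|]; rewrite ?E.
    rewrite mulr_ge0 ?invr_ge0 ?(ltW sz) // big_seq sumr_ge0 // => v /hu[+ _].
    exact.
  rewrite (eq_bigr _ (fun j _ => E j)) -mulr_sumr exchange_big /= big_seq.
  rewrite (eq_bigr (fun=> 1)); last by move=> v /hu[].
  rewrite -big_seq big_const_seq count_predT iter_addr_0.
  by rewrite mulVf ?gt_eqF.
have {}h := h Q Qb.
move=> v /h [|v0 <-].
  move=> w /hb[i id ->]; have iN : (i < n)%N by exact: leq_trans id dn.
  have E (j : 'I_n) : (-1) ^+ b j * ((-1) ^+ b i *: unit_row i) ord0 j = (j == i :> nat)%:R.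
    rewrite !mxE; case: eqP => [->|_]; last by rewrite !mulr0.
    by rewrite signrMK.
  split=> [j|]; first by rewrite E.
  rewrite (eq_bigr _ (fun j _ => E j)) (bigD1 (Ordinal iN)) //= eqxx big1 ?addr0 //.
  move=> j ji; rewrite (_ : (j == i :> nat) = false) //.
  by apply: contraNF ji => /eqP e; apply/eqP/val_inj.
apply: eq_bigr => j _; have := v0 j; rewrite -{2}[v ord0 j](signrMK (b j)).
by rewrite normrM normr_sign mul1r => /ger0_norm ->.
Qed.

Lemma norm1_continuous : continuous norm1.
Proof.
apply: continuous_sumr => i x.
apply: (@continuous_comp _ _ _ (fun y : V => y ord0 i) Num.norm).
  exact: coord_continuous.
exact: norm_continuous.
Qed.

Lemma norm1_sphere_compact : compact [set x : V | norm1 x = 1].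
Proof.
apply: bounded_closed_compact.
  exists 1; split=> // M M1 x /= x1; apply: le_trans (ltW M1).
  rewrite /Num.norm /= mx_normrE; apply: bigmax_le => // -[i k] _ /=.
  rewrite (ord1 i) -x1 /norm1 (bigD1 k) //= lerDl sumr_ge0 //.
have -> : [set x : V | norm1 x = 1] = norm1 @^-1` [set 1] by [].
by apply: preimage_closed => [x _|]; [exact: norm1_continuous|exact: closed_eq].
Qed.

Lemma norm1_neq0 x : norm1 x = 1 -> x != 0.
Proof.
move=> x1; apply/eqP => x0; move: x1; rewrite x0 /norm1 big1.
  by move/eqP; rewrite eq_sym oner_eq0.
by move=> i _; rewrite mxE normr0.
Qed.

(** * An odd choice of coordinate signs for an odd map *)

Section OddSigns.
Variables (j : nat) (h : V -> 'rV[R]_j).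

(* A vanishing coordinate is given the sign of the first nonzero one, which keeps
   the choice odd. *)
Definition odd_sign (i : nat) (x : V) : bool :=
  let y := h x in
  let t := if insub i is Some k then y ord0 k else 0 in
  if t != 0 then 0 < t else
  if [pick k | y ord0 k != 0] is Some k then 0 < y ord0 k else false.

Lemma odd_signN i x : h (- x) = - h x -> h x != 0 ->
  odd_sign i (- x) = ~~ odd_sign i x.
Proof.
move=> hN h0; rewrite /odd_sign hN.
have pos (a : R) : a != 0 -> (0 < - a) = ~~ (0 < a).
  by move=> a0; rewrite oppr_gt0 -leNgt le_eqVlt (negbTE a0).
have -> : (if insub i is Some k then (- h x) ord0 k else 0) =
    - (if insub i is Some k then h x ord0 k else 0) :> R.
  by case: insubP => [k _ _|_]; rewrite ?mxE ?oppr0.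
rewrite oppr_eq0; case: ifP => [t0|_]; first exact: pos.
rewrite (eq_pick (_ : _ =1 [pred k | h x ord0 k != 0])); last first.
  by move=> k /=; rewrite mxE oppr_eq0.
case: pickP => [k hk|hk]; first by rewrite mxE pos.
case/eqP: h0; apply/rowP => k; rewrite mxE.
by have /negbT := hk k; rewrite negbK => /eqP.
Qed.

Lemma odd_signE (k : 'I_j) x : h x ord0 k != 0 -> odd_sign k x = (0 < h x ord0 k).
Proof. by rewrite /odd_sign valK => ->. Qed.

End OddSigns.

Lemma borsuk_ulam (j : nat) (h : V -> 'rV[R]_j) : (j < n)%N ->
  (forall x, x != 0 -> {for x, continuous h}) ->
  (forall x, x != 0 -> h (- x) = - h x) ->
  exists2 x, x != 0 & h x = 0.
Proof.
move=> jn hc hN; apply: contrapT => noz.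
have h0 x : x != 0 -> h x != 0.
  by move=> x0; apply/eqP => hx; apply: noz; exists x.
pose sg := odd_sign h; pose c : R := n%:R / n.+1%:R.
have step (N : nat) : exists s : seq V, [/\ size s = j.+1,
    (forall v, v \in s -> norm1 v = 1), small (c ^+ N * 2) s & cupB sg 0 s].
  have [|s sH cs] := @alternating_simplex _ bary -%R unit_row (@opprK _) baryN sg N j.
    move=> m s v i mj sH vs; apply: odd_signN; last apply: h0.
      by apply: hN; apply/norm1_neq0/(hemi_norm1 _ sH vs)/(ltn_trans mj).
    exact/norm1_neq0/(hemi_norm1 _ sH vs)/(ltn_trans mj).
  exists s; split=> //; first exact: (sdN_size (@hemi_size _ _ _ j) sH).
    by move=> v; exact: hemi_norm1 sH v.
  apply: sdN_small sH; [exact: ltnW|exact: hemi_size|].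
  (* The initial mesh 2: the sup norm is at most [norm1], which is 1 at both vertices. *)
  move=> t /(@hemi_norm1 j 0) t1 u v /t1 u1 /t1 v1.
  have le1 w : norm1 w = 1 -> `|w| <= 1.
    move=> w1; rewrite /Num.norm /= mx_normrE; apply: bigmax_le => // -[i k] _ /=.
    by rewrite (ord1 i) -w1 /norm1 (bigD1 k) //= lerDl sumr_ge0.
  by rewrite (le_trans (ler_normB _ _)) // -[leRHS]/(1 + 1) lerD ?le1 ?u1 ?v1.
have [s sP] := choice step.
(* Any vertex would do, since the mesh tends to 0. *)
pose v N := nth 0 (s N) 0.
have [|x [x1 xv]] := norm1_sphere_compact (F := v @ \oo) _.
  exists 0%N => // N _ /=; have [sz + _ _] := sP N; apply.
  by rewrite mem_nth // sz.
have /rV0Pn [k hk] : h x != 0 by apply/h0/norm1_neq0.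
(* [f y] is positive exactly when the [k]-th coordinate of [h y] has the same strict sign as that of
   [h x]. *)
pose f y := h x ord0 k * h y ord0 k.
have fc : {for x, continuous f}.
  apply: (entry_continuous (phi := id)); last by move=> y; exact: cvg_id.
  by apply: hc; exact: norm1_neq0.
have : \forall y \near x, 0 < f y.
  by apply: (cvgr_gt (f x)) fc _ _; rewrite /f -expr2 exprn_even_gt0.
move=> /nbhs_ballP[r r0 rf].
have : (c ^+ N * 2) @[N --> \oo] --> (0 * 2 : R).
  apply: cvgMr_tmp.
  apply: cvg_expr; rewrite ger0_norm ?divr_ge0 //.
  by rewrite ltr_pdivrMr ?ltr0n // mul1r ltr_nat.
(* One half of [r] pays for the distance from [x] to the first vertex, the other for the mesh. *)
rewrite mul0r => /cvgrPdist_lt /(_ (r / 2)) []; first by rewrite divr_gt0.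
move=> N0 _ hN0.
have [_ [[N /= NN0 <-] xN]] : [set v N | N in [set N | (N0 <= N)%N]] `&` ball x (r / 2) !=set0.
  apply: xv; last by apply: nbhsx_ballx; rewrite divr_gt0.
  by exists N0 => // N /= NN; exists N.
have [sz sn1 sms cs] := sP N.
have posf (i : nat) : (i < j.+1)%N -> 0 < f (nth 0 (s N) i).
  move=> ij; apply: rf; rewrite (splitr r); apply: ball_triangle xN _.
  rewrite -ball_normE /=; apply: le_lt_trans (sms _ _ _ _) _; rewrite ?mem_nth ?sz //.
  by have := hN0 N NN0; rewrite /= sub0r normrN ger0_norm // mulr_ge0 ?exprn_ge0 ?divr_ge0.
(* The contradiction: the [k]-th sign changes between vertices [k] and [k.+1], yet near [x] it is
   constant. *)
have := cupB_nth 0 cs (j := k); rewrite sz ltnS ltn_ord add0n => /(_ isT).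
have sgE y : 0 < f y -> sg k y = (0 < h x ord0 k).
  rewrite /f => fy; have hy : h y ord0 k != 0.
    by apply: contraTneq fy => ->; rewrite mulr0 ltxx.
  rewrite /sg odd_signE //; move: hk; rewrite neq_lt => /orP[] hx.
    by move: fy; rewrite nmulr_rgt0 // => hy0; rewrite !ltNge !ltW.
  by rewrite -(pmulr_rgt0 _ hx) fy hx.
have kj := ltn_ord k.
rewrite !sgE ?eqxx //; apply: posf => //; exact: ltnW.
Qed.

End BorsukUlam.

(** * Spectra of symmetric matrices and interlacing *)

Section Spectral.
Variable R : rcfType.

Lemma rV_mul_tr m (u : 'rV[R]_m) :
  (u *m u^T) ord0 ord0 = \sum_i u ord0 i ^+ 2.
Proof. by rewrite mxE; apply: eq_bigr => i _; rewrite [u^T _ _]mxE expr2. Qed.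

Lemma rV_sum_sqr_gt0 m (u : 'rV[R]_m) : u != 0 -> 0 < \sum_i u ord0 i ^+ 2.
Proof.
move=> /rV0Pn[i ui]; rewrite (bigD1 i) //= ltr_wpDr //.
  by rewrite sumr_ge0 // => j _; exact: sqr_ge0.
by rewrite exprn_even_gt0.
Qed.

(** Over the complex numbers [S] is Hermitian, so its spectral diagonal is real; a real root of the
    complexified characteristic polynomial is a root of the original one. *)
Lemma symmetric_eigenvalue m (S : 'M[R]_m) : (0 < m)%N -> S^T = S ->
  exists a, eigenvalue S a.
Proof.
case: m S => // m S _ St; pose SC := map_mx (real_complex R) S.
have Sh : SC \is hermsymmx.
  apply: realsym_hermsym.
    apply/is_hermitianmxP; rewrite expr0 scale1r map_mx_id //.
    by rewrite /SC map_trmx St.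
  by apply/mxOverP => i j; rewrite mxE; apply/complex_realP; exists (S i j).
have /mxOverP/(_ ord0 ord0)/complex_realP[a ea] := hermitian_spectral_diag_real Sh.
have /orthomx_spectralP E := hermitian_normalmx Sh.
exists a; rewrite eigenvalue_root_char -(fmorph_root (real_complex R)).
rewrite map_char_poly -/SC -eigenvalue_root_char.
apply/eigenvalueP; exists (row ord0 (spectralmx SC)).
  have := congr1 (mulmx (spectralmx SC)) E.
  rewrite !mulmxA mulmxV ?spectral_unit // mul1mx => PE.
  by rewrite -row_mul PE row_mul row_diag_mx -scalemxAl -rowE ea.
apply/eqP => r0; have := spectral_unit SC.
rewrite -row_free_unit => /row_freeP[B] /(congr1 (row ord0)).
rewrite row_mul r0 mul0mx row1 => /rowP/(_ ord0); rewrite !mxE !eqxx => /eqP.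
by rewrite eq_sym oner_eq0.
Qed.

Lemma char_poly_similar m (P P' N : 'M[R]_m) : P *m P' = 1%:M ->
  char_poly (P *m N *m P') = char_poly N.
Proof.
move=> PP; rewrite /char_poly /char_poly_mx !map_mxM.
have PPc : map_mx polyC P *m map_mx polyC P' = 1%:M by rewrite -map_mxM PP map_mx1.
have XE : 'X%:M = map_mx polyC P *m 'X%:M *m map_mx polyC P'.
  by rewrite scalar_mxC -mulmxA PPc mulmx1.
rewrite [in LHS]XE -mulmxBl -mulmxBr !det_mulmx mulrAC -det_mulmx PPc det1 mul1r.
by [].
Qed.

(** The reflection in the hyperplane orthogonal to [e - v] swaps the unit vectors [e] and [v]; if
    they coincide, the identity serves. *)
Lemma householder m (v : 'rV[R]_m.+1) : v *m v^T = 1%:M ->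
  exists H : 'M[R]_m.+1, [/\ H^T = H, H *m H = 1%:M & row ord0 H = v].
Proof.
move=> v1; pose e : 'rV[R]_m.+1 := delta_mx 0 0.
have [u ue] : exists u, u = e - v by exists (e - v).
have [u0|u0] := eqVneq u 0.
  exists 1%:M; rewrite trmx1 mul1mx row1; split=> //.
  by rewrite -[RHS](subKr e) -ue u0 subr0.
have ev : e *m v^T = (v ord0 ord0)%:M.
  by apply/matrixP => i j; rewrite /e -rowE !ord1 !mxE eqxx.
have ve : v *m e^T = (v ord0 ord0)%:M.
  by rewrite -[LHS]trmxK trmx_mul trmxK ev tr_scalar_mx.
have ee : e *m e^T = 1%:M.
  rewrite /e trmx_delta mul_delta_mx.
  by apply/matrixP => i j; rewrite !ord1 !mxE eqxx.
have uu : u *m u^T = (2 - 2 * v ord0 ord0)%:M.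
  rewrite ue linearB /= mulmxBl !mulmxBr v1 ev ve ee.
  apply/matrixP => i j; rewrite !ord1 !mxE eqxx /= !mulr1n.
  ring.
(* The squared length of [e - v]. *)
pose b := 2 - 2 * v ord0 ord0.
have b0 : b != 0.
  have := rV_sum_sqr_gt0 u0; rewrite -rV_mul_tr uu !mxE eqxx mulr1n.
  exact: lt0r_neq0.
have UU : (u^T *m u) *m (u^T *m u) = b *: (u^T *m u).
  by rewrite mulmxA -(mulmxA u^T) uu -/b mul_mx_scalar -scalemxAl.
exists (1%:M - (2 / b) *: (u^T *m u)); split.
- by rewrite linearB /= trmx1 linearZ /= trmx_mul trmxK.
- rewrite mulmxBl mul1mx mulmxBr mulmx1 -scalemxAl -scalemxAr UU !scalerA.
  have -> : 2 / b * (2 / b) * b = 2 / b + 2 / b by field.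
  by rewrite scalerDl opprB addrK subrK.
- rewrite rowE mulmxBr mulmx1 -scalemxAr mulmxA.
  have -> : delta_mx 0 ord0 *m u^T = (b / 2)%:M.
    apply/matrixP => i j; rewrite !ord1 !mxE (bigD1 ord0) //= big1 => [|k k0].
      by rewrite ue !mxE !eqxx /= /b; field.
    by rewrite !mxE (negbTE k0) andbF mul0r.
  rewrite mul_scalar_mx scalerA; have -> : 2 / b * (b / 2) = 1 by field.
  by rewrite scale1r ue subKr.
Qed.

Lemma diagonalization_block m (a : R) (Q : 'M[R]_m) (d : 'rV[R]_m)
  (Q1 : 'M[R]_(1 + m) := block_mx 1%:M 0 0 Q) : Q *m Q^T = 1%:M ->
  Q1 *m Q1^T = 1%:M /\
  block_mx a%:M 0 0 (Q *m diag_mx d *m Q^T) =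
    Q1 *m diag_mx (row_mx (a%:M : 'M[R]_1) d) *m Q1^T.
Proof.
move=> QQ; rewrite /Q1 tr_block_mx trmx1 !trmx0; split.
  rewrite mulmx_block QQ !mul0mx !mulmx0 mulmx1 !addr0 add0r.
  by rewrite -scalar_mx_block.
rewrite diag_mx_row !mulmx_block.
rewrite !(mul0mx, mulmx0, mulmx1, mul1mx, addr0, add0r).
congr block_mx.
by apply/matrixP => i j; rewrite !ord1 !mxE eqxx.
Qed.

(** Deflation: conjugating by a reflection whose first row is a unit eigenvector clears the first
    row, hence by symmetry the first column, off the diagonal; induction treats the remaining
    block. *)
Lemma symmetric_diagonalization m (S : 'M[R]_m) : S^T = S ->
  exists (Q : 'M[R]_m) (d : 'rV[R]_m), Q *m Q^T = 1%:M /\ S = Q *m diag_mx d *m Q^T.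
Proof.
elim: m S => [|m IH] S St.
  by exists 1%:M, 0; split; apply/matrixP => -[].
have [a /eigenvalueP[v0 v0S v0n]] := symmetric_eigenvalue (ltn0Sn m) St.
pose t := (v0 *m v0^T) ord0 ord0.
have t0 : 0 < t by rewrite /t rV_mul_tr rV_sum_sqr_gt0.
pose v := (Num.sqrt t)^-1 *: v0.
have vS : v *m S = a *: v by rewrite -scalemxAl v0S !scalerA mulrC.
have v1 : v *m v^T = 1%:M.
  rewrite /v linearZ /= -scalemxAl -scalemxAr scalerA -invfM -expr2 sqr_sqrtr ?ltW //.
  by apply/matrixP => i j; rewrite !ord1 mxE -/t mulVf ?gt_eqF // mxE eqxx.
have [H [Ht HH H0]] := householder v1.
have [B BE] : exists B : 'M[R]_(1 + m), B = H *m S *m H by exists (H *m S *m H).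
have Bt : B^T = B by rewrite BE !trmx_mul Ht St mulmxA.
have B0 : row ord0 B = a *: delta_mx 0 0.
  by rewrite BE -mulmxA !row_mul H0 mulmxA vS -scalemxAl -H0 -row_mul HH row1.
have Bur : ursubmx B = 0.
  apply/matrixP => i j; rewrite ord1 !mxE.
  have := congr1 (fun r : 'rV_ _ => r ord0 (rshift 1 j)) B0.
  by rewrite !mxE (_ : lshift m ord0 = ord0) ?mulr0 //; apply/val_inj.
have Bul : ulsubmx B = a%:M.
  apply/matrixP => i j; rewrite !ord1 !mxE.
  have := congr1 (fun r : 'rV_ _ => r ord0 (lshift m ord0)) B0.
  by rewrite !mxE (_ : lshift m ord0 = ord0) ?mulr1 ?eqxx ?mulr1n //; apply/val_inj.
have Bdl : dlsubmx B = 0 by rewrite -Bt -trmx_ursub Bur trmx0.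
have Bdr : (drsubmx B)^T = drsubmx B by rewrite trmx_drsub Bt.
have [Q [d [QQ E]]] := IH _ Bdr.
have [Q1 [QQ1 BQ]] : exists Q1 : 'M[R]_m.+1, Q1 *m Q1^T = 1%:M /\
    B = Q1 *m diag_mx (row_mx a%:M d : 'rV_(1 + m)) *m Q1^T.
  exists (block_mx 1%:M 0 0 Q : 'M[R]_(1 + m)).
  rewrite -[B](@submxK _ 1 m 1 m) Bur Bdl Bul E.
  exact: diagonalization_block.
exists (H *m Q1), (row_mx a%:M d : 'rV_(1 + m)).
rewrite trmx_mul Ht; split.
  by rewrite mulmxA -(mulmxA H) QQ1 mulmx1.
have -> : S = H *m B *m H.
  by rewrite BE !mulmxA HH mul1mx -mulmxA HH mulmx1.
by rewrite {1}BQ !mulmxA.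
Qed.
End Spectral.

(** * Ordered eigenvalues and counting *)

Section SortedCount.
Variables (R : realDomainType).
Implicit Types (s : seq R).

Lemma count_lt_nth s k : sorted <=%R s -> (k < size s)%N ->
  (count (fun x => x < nth 0 s k)%R s <= k)%N.
Proof.
move=> ss ks; rewrite -[in X in count _ X](cat_take_drop k s) count_cat.
rewrite [X in (_ + X)%N](_ : _ = 0)%N.
  by rewrite addn0 (leq_trans (count_size _ _)) // size_take ks.
apply/eqP; rewrite -leqn0 leqNgt -has_count -all_predC; apply/(all_nthP 0) => i.
rewrite size_drop ltn_subRL => ik; rewrite nth_drop /= -leNgt.
by rewrite (sorted_leq_nth le_trans le_refl) // ?inE // leq_addr.
Qed.

Lemma count_gt_nth s k : sorted <=%R s -> (k < size s)%N ->
  (count (fun x => nth 0 s k < x)%R s <= size s - k.+1)%N.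
Proof.
move=> ss ks; rewrite -[in X in count _ X](cat_take_drop k.+1 s) count_cat.
rewrite [X in (X + _)%N](_ : _ = 0)%N.
  by rewrite add0n (leq_trans (count_size _ _)) // size_drop.
apply/eqP; rewrite -leqn0 leqNgt -has_count -all_predC; apply/(all_nthP 0) => i.
rewrite size_take_min => /leq_trans /(_ (geq_minl _ _)) ik; rewrite nth_take //= -leNgt.
rewrite (sorted_leq_nth le_trans le_refl) // inE.
exact: leq_ltn_trans ks.
Qed.

End SortedCount.

Lemma card_count (R : realType) m (d : 'rV[R]_m) (s : seq R) (p : pred R) :
  perm_eq s [seq d ord0 i | i : 'I_m] ->
  #|[pred i | p (d ord0 i)]| = count p s.
Proof.
by move=> /permP ->; rewrite count_map cardE enumT size_filter.
Qed.

(** A factorization into linear factors excludes the default value of [eigs], and its uniqueness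
    gives the permutation. *)
Lemma eigsP (R : realType) m (M : 'M[R]_m) (s : seq R) :
  char_poly M = \prod_(x <- s) ('X - x%:P) ->
  sorted <=%R (eigs M) /\ perm_eq (eigs M) s.
Proof.
move=> Ms; rewrite /eigs; case: pselect => [H|[]]; last first.
  exists (sort <=%R s); split; first exact: sort_le_sorted.
  by rewrite Ms; apply: perm_big; rewrite perm_sym perm_sort.
case: (cid H) => t /= [tsort Mt]; split=> //.
by apply: prod_XsubC_eq; rewrite -Mt.
Qed.

Lemma quad_diag (R : comPzRingType) m (y d : 'rV[R]_m) :
  (y *m diag_mx d *m y^T) ord0 ord0 = \sum_i d ord0 i * y ord0 i ^+ 2.
Proof.
rewrite mul_mx_diag mxE; apply: eq_bigr => i _.
by rewrite !mxE mulrAC mulrC expr2.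
Qed.

(** With [D = diag(mu)], the matrix [D^-1 A] is similar to the symmetric [D^(-1/2) A D^(-1/2)]. If
    [Q] diagonalizes the latter, [W = D^(1/2) Q] diagonalizes both quadratic forms at once, and
    [x *m W] lists the eigencoordinates of [x]. *)
Lemma weighted_diagonalization (R : realType) m (A : 'M[R]_m) (mu : 'I_m -> R) :
  A^T = A -> (forall i, 0 < mu i) ->
  exists (W : 'M[R]_m) (d : 'rV[R]_m), [/\
    forall x : 'rV_m, (x *m A *m x^T) ord0 ord0 =
      \sum_i d ord0 i * (x *m W) ord0 i ^+ 2,
    forall x : 'rV_m, \sum_i mu i * x ord0 i ^+ 2 =
      \sum_i (x *m W) ord0 i ^+ 2,
    sorted <=%R (eigs (\matrix_(i, j) ((mu i)^-1 * A i j))) &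
    perm_eq (eigs (\matrix_(i, j) ((mu i)^-1 * A i j)))
      [seq d ord0 i | i : 'I_m]].
Proof.
move=> At mu0; pose r : 'rV[R]_m := \row_i Num.sqrt (mu i).
pose r' : 'rV[R]_m := \row_i (Num.sqrt (mu i))^-1.
have s0 i : Num.sqrt (mu i) != 0 by rewrite gt_eqF // sqrtr_gt0.
have rr' : diag_mx r *m diag_mx r' = 1%:M.
  rewrite mulmx_diag -diag_const_mx; congr diag_mx.
  by apply/rowP => i; rewrite !mxE mulfV.
have r'r : diag_mx r' *m diag_mx r = 1%:M by exact: mulmx1C.
have St : (diag_mx r' *m A *m diag_mx r')^T = diag_mx r' *m A *m diag_mx r'.
  by rewrite !trmx_mul !tr_diag_mx At mulmxA.
have [Q [d [QQ E]]] := symmetric_diagonalization St.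
have AE : A = (diag_mx r *m Q) *m diag_mx d *m (diag_mx r *m Q)^T.
  have -> : diag_mx r *m Q *m diag_mx d *m (diag_mx r *m Q)^T =
    diag_mx r *m (Q *m diag_mx d *m Q^T) *m diag_mx r.
    by rewrite trmx_mul tr_diag_mx !mulmxA.
  by rewrite -E !mulmxA rr' mul1mx -mulmxA r'r mulmx1.
have WW : (diag_mx r *m Q) *m (diag_mx r *m Q)^T = diag_mx (\row_i mu i).
  rewrite trmx_mul tr_diag_mx mulmxA -(mulmxA _ Q) QQ mulmx1 mulmx_diag.
  congr diag_mx; apply/rowP => i.
  by rewrite !mxE -expr2 sqr_sqrtr // ltW.
have charE : char_poly (\matrix_(i, j) ((mu i)^-1 * A i j)) =
    \prod_(x <- [seq d ord0 i | i : 'I_m]) ('X - x%:P).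
  have -> : \matrix_(i, j) ((mu i)^-1 * A i j) =
      (diag_mx r' *m Q) *m diag_mx d *m (Q^T *m diag_mx r).
    have -> : diag_mx r' *m Q *m diag_mx d *m (Q^T *m diag_mx r) =
      diag_mx r' *m (Q *m diag_mx d *m Q^T) *m diag_mx r by rewrite !mulmxA.
    rewrite -E !mulmxA -mulmxA r'r mulmx1 mulmx_diag mul_diag_mx.
    apply/matrixP => i j; rewrite !mxE.
    by rewrite -invfM -expr2 sqr_sqrtr // ltW.
  rewrite char_poly_similar; last by rewrite mulmxA -(mulmxA _ Q) QQ mulmx1.
  rewrite char_poly_trig ?diag_mx_is_trig // big_map big_enum.
  by apply: eq_bigr => i _; rewrite mxE eqxx mulr1n.
have [? ?] := eigsP charE.
exists (diag_mx r *m Q), d; split=> // x; rewrite -?quad_diag.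
  by rewrite {1}AE !trmx_mul !mulmxA.
rewrite (eq_bigr (fun i => (\row_i mu i) ord0 i * x ord0 i ^+ 2)); last first.
  by move=> i _; rewrite [(\row_i mu i) _ _]mxE.
by rewrite -quad_diag -WW -rV_mul_tr !trmx_mul !mulmxA.
Qed.

(** [d] is unordered, so these counts replace the position of the [k]-th eigenvalue in a sorted
    list. *)
Lemma eigval_counts (R : realType) m (M : 'M[R]_m) (d : 'rV[R]_m) k :
  sorted <=%R (eigs M) -> perm_eq (eigs M) [seq d ord0 i | i : 'I_m] ->
  (0 < k <= m)%N ->
  (#|[pred i | d ord0 i < eigval M k]%R| < k)%N /\
  (#|[pred i | eigval M k < d ord0 i]%R| <= m - k)%N.
Proof.
move=> Ms Md /andP[k0 km]; have sz : size (eigs M) = m.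
  by rewrite (perm_size Md) size_map -cardE card_ord.
rewrite (card_count (fun x => x < eigval M k) Md).
rewrite (card_count (fun x => eigval M k < x) Md) /eigval.
have kk : (k.-1 < size (eigs M))%N by rewrite sz prednK.
split; first by rewrite -[X in (_ < X)%N](prednK k0) ltnS count_lt_nth.
by have := count_gt_nth Ms kk; rewrite sz prednK.
Qed.

Lemma exists_kernel_row (F : fieldType) m c (A : 'M[F]_(m, c)) : (c < m)%N ->
  exists2 z : 'rV_m, z != 0 & z *m A = 0.
Proof.
move=> cm; have : kermx A != 0.
  by rewrite -mxrank_eq0 mxrank_ker -lt0n subn_gt0 (leq_ltn_trans (rank_leq_col A)).
by move=> /rowV0Pn[z /sub_kermxP zA z0]; exists z.
Qed.

(** * Quadratic forms of subgraphs and Cauchy interlacing *)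

Section Forms.
Variables (R : realType) (n : nat) (sg w : 'I_n -> 'I_n -> R) (mu : 'I_n -> R).
Implicit Types f : 'rV[R]_n.

(** The sum runs over ordered pairs, so for symmetric [E0] every edge counts twice. *)
Definition edge_form (E0 : rel 'I_n) f : R := \sum_(i < n) \sum_(j < n | E0 i j)
  - sg i j * w i j * f ord0 i * f ord0 j.

Definition mass f : R := \sum_(i < n) mu i * f ord0 i ^+ 2.

Definition restr (V0 : {set 'I_n}) f : 'rV[R]_#|V0| := \row_a f ord0 (enum_val a).

(** Right multiplication by it is extension by zero; its transpose restricts. *)
Definition extmx (V0 : {set 'I_n}) : 'M[R]_(#|V0|, n) := \matrix_(a, i) (enum_val a == i)%:R.

Lemma extmx_val (V0 : {set 'I_n}) (z : 'rV[R]_#|V0|) a :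
  (z *m extmx V0) ord0 (enum_val a) = z ord0 a.
Proof.
rewrite mxE (bigD1 a) //= mxE eqxx mulr1 big1 ?addr0 // => b ba.
by rewrite mxE (inj_eq enum_val_inj) (negbTE ba) mulr0.
Qed.

Lemma extmx_out (V0 : {set 'I_n}) (z : 'rV[R]_#|V0|) i : i \notin V0 -> (z *m extmx V0) ord0 i = 0.
Proof.
move=> iV; rewrite mxE big1 // => b _; rewrite mxE.
by rewrite (_ : _ == _ = false) ?mulr0 //; apply: contraNF iV => /eqP <-; exact: enum_valP.
Qed.

Lemma restr_ext (V0 : {set 'I_n}) (z : 'rV[R]_#|V0|) : restr V0 (z *m extmx V0) = z.
Proof. by apply/rowP => a; rewrite mxE extmx_val. Qed.

Hypothesis mu_gt0 : forall i, 0 < mu i.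

(** Edges of [E0] lie in [V0], so the edge form sees only the restriction of [f]; the mass does so
    only when [f] is supported in [V0]. *)
Lemma subgraph_spectrum (V0 : {set 'I_n}) (E0 : rel 'I_n) k :
  (forall i j, E0 i j -> [/\ E0 j i, i \in V0, j \in V0, sg i j = sg j i & w i j = w j i]) ->
  (0 < k <= #|V0|)%N ->
  exists (W : 'M[R]_#|V0|) (d : 'rV[R]_#|V0|), [/\
    forall f, edge_form E0 f = \sum_a d ord0 a * (restr V0 f *m W) ord0 a ^+ 2,
    forall f, (forall i, i \notin V0 -> f ord0 i = 0) ->
      mass f = \sum_a (restr V0 f *m W) ord0 a ^+ 2,
    (#|[pred a | d ord0 a < eigval (Amu_neg sg w mu V0 E0) k]%R| < k)%N &
    (#|[pred a | eigval (Amu_neg sg w mu V0 E0) k < d ord0 a]%R| <= #|V0| - k)%N].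
Proof.
move=> hE hk.
pose A : 'M[R]_#|V0| := \matrix_(a, b)
  if E0 (enum_val a) (enum_val b) then
    - sg (enum_val a) (enum_val b) * w (enum_val a) (enum_val b) else 0.
have At : A^T = A.
  apply/matrixP => a b; rewrite !mxE; case: ifP => [/hE[-> _ _ -> ->] //|].
  by case: ifP => // /hE[->].
have MA : Amu_neg sg w mu V0 E0 = \matrix_(a, b) ((mu (enum_val a))^-1 * A a b).
  by apply/matrixP => a b; rewrite !mxE.
have [W [d [hA hm hs hp]]] :=
  weighted_diagonalization At (fun a : 'I_#|V0| => mu_gt0 (enum_val a)).
rewrite -MA in hs hp; have [h1 h2] := eigval_counts hs hp hk.
exists W, d; split=> // f.
  rewrite -hA; have -> : edge_form E0 f =
      \sum_(i in V0) \sum_(j in V0) (if E0 i j then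
        - sg i j * w i j * f ord0 i * f ord0 j else 0).
    rewrite /edge_form [RHS]big_mkcond /=; apply: eq_bigr => i _.
    case: ifP => iV.
      rewrite big_mkcond [RHS]big_mkcond; apply: eq_bigr => j _.
      by case: ifP => [/hE[_ _ ->]|]; rewrite // if_same.
    by rewrite big1 // => j /hE[_]; rewrite iV.
  transitivity (\sum_a \sum_b restr V0 f ord0 a * A a b * restr V0 f ord0 b).
    rewrite big_enum_val; apply: eq_bigr => a _; rewrite big_enum_val.
    by apply: eq_bigr => b _; rewrite !mxE; case: ifP => _; ring.
  rewrite exchange_big mxE; apply: eq_bigr => b _ /=.
  rewrite [(_ *m A) _ _]mxE mulr_suml; apply: eq_bigr => a _.
  by rewrite [_^T _ _]mxE.
move=> f0; rewrite -hm /mass (bigID (mem V0)) /= [X in _ + X]big1 ?addr0.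
  by rewrite big_enum_val; apply: eq_bigr => a _; rewrite mxE.
by move=> i /f0 ->; rewrite expr0n mulr0.
Qed.

(* Cauchy interlacing: the two families of constraints in the proof are too few
   to exclude a nonzero vector supported in [V0]. *)
Lemma eigval_interlacing (V0 : {set 'I_n}) (E0 : rel 'I_n) k :
  (forall i j, E0 i j -> [/\ E0 j i, i \in V0, j \in V0, sg i j = sg j i & w i j = w j i]) ->
  (0 < k <= n)%N -> (n < #|V0| + k)%N ->
  eigval (Amu_neg sg w mu V0 E0) (#|V0| + k - n) <=
  eigval (Amu_neg sg w mu [set: 'I_n]%SET E0) k.
Proof.
move=> hE /andP[k0 kn] hV; set j := (#|V0| + k - n)%N.
have Vn : (#|V0| <= n)%N by rewrite -[X in (_ <= X)%N]card_ord max_card.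
have Tn : #|[set: 'I_n]%SET| = n by rewrite cardsT card_ord.
have hj : (0 < j <= #|V0|)%N by rewrite subn_gt0 hV leq_subLR addnC leq_add2r.
have hE' i1 j1 : E0 i1 j1 -> [/\ E0 j1 i1, i1 \in [set: 'I_n]%SET, j1 \in [set: 'I_n]%SET,
    sg i1 j1 = sg j1 i1 & w i1 j1 = w j1 i1].
  by move=> /hE[? _ _ ? ?]; rewrite !inE.
have hkT : (0 < k <= #|[set: 'I_n]%SET|)%N by rewrite k0 Tn.
have [W [d [qW mW cW _]]] := subgraph_spectrum hE hj.
have [U [e [qU mU _ cU]]] := subgraph_spectrum hE' hkT.
set x := eigval _ j in cW *; set y := eigval _ k in cU *.
rewrite leNgt; apply/negP => xy.
pose P1 := [pred a | d ord0 a < x]; pose P2 := [pred a | y < e ord0 a].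
(* From a vector on [V0] to the eigencoordinates of the spanning graph. *)
pose X := extmx V0 *m (extmx [set: 'I_n]%SET)^T *m U.
pose M1 : 'M[R]_(#|V0|, #|P1|) := \matrix_(a, b) W a (enum_val b).
pose M2 : 'M[R]_(#|V0|, #|P2|) := \matrix_(a, b) X a (enum_val b).
(* Fewer than [j] conditions kill the eigenvalues below [x], and at most [n - k] kill those above
   [y]; together fewer than [j + (n - k)], which is the size of [V0]. *)
have [|z z0 /eqP] := exists_kernel_row (row_mx M1 M2).
  apply: (@leq_trans (j + #|P2|)); first by rewrite ltn_add2r.
  rewrite (leq_trans (leq_add (leqnn j) cU)) // Tn /j.
  by rewrite addnBA // subnK ?addnK // ltnW.
rewrite mul_mx_row -(row_mx0 R 1) => /eqP/eq_row_mx[z1 z2].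
pose f := z *m extmx V0.
have rT : restr [set: 'I_n]%SET f = z *m (extmx V0 *m (extmx [set: 'I_n]%SET)^T).
  apply/rowP => a; rewrite [LHS]mxE mulmxA -/f [RHS]mxE (bigD1 (enum_val a)) //=.
  rewrite [_^T _ _]mxE [extmx _ _ _]mxE eqxx mulr1 big1 ?addr0 // => b ba.
  by rewrite [_^T _ _]mxE [extmx _ _ _]mxE eq_sym (negbTE ba) mulr0.
have f0 i : i \notin V0 -> f ord0 i = 0 by exact: extmx_out.
have fT i : i \notin [set: 'I_n]%SET -> f ord0 i = 0 by rewrite inE.
have mass0 : 0 < mass f.
  have : f != 0.
    apply: contra_neq z0 => f0'; apply/rowP => a.
    by rewrite -(extmx_val z) -/f f0' !mxE.
  move=> /rV0Pn[i fi]; rewrite /mass (bigD1 i) //= ltr_wpDr //.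
    by rewrite sumr_ge0 // => l _; rewrite mulr_ge0 ?sqr_ge0 // ltW.
  by rewrite mulr_gt0 // exprn_even_gt0.
have lo : x * mass f <= edge_form E0 f.
  rewrite (mW _ f0) qW restr_ext mulr_sumr; apply: ler_sum => a _.
  have [ax|ax] := leP x (d ord0 a); first by rewrite ler_wpM2r ?sqr_ge0.
  have aP : a \in P1 by rewrite inE.
  have := congr1 (fun r : 'rV_ _ => r ord0 (enum_rank_in aP a)) z1.
  rewrite !mxE; under eq_bigr do rewrite mxE enum_rankK_in //.
  by move=> ->; rewrite expr0n !mulr0.
have hi : edge_form E0 f <= y * mass f.
  rewrite (mU _ fT) qU mulr_sumr; apply: ler_sum => a _.
  have [ay|ay] := leP (e ord0 a) y; first by rewrite ler_wpM2r ?sqr_ge0.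
  have aP : a \in P2 by rewrite inE.
  have := congr1 (fun r : 'rV_ _ => r ord0 (enum_rank_in aP a)) z2.
  rewrite rT -mulmxA -/X ![in X in X -> _]mxE.
  rewrite [(z *m X) _ _]mxE; under eq_bigr do rewrite mxE enum_rankK_in //.
  by move=> ->; rewrite expr0n !mulr0.
have := le_trans lo hi; rewrite ler_pM2r // => /(lt_le_trans xy).
by rewrite ltxx.
Qed.

End Forms.

(** * The p-Rayleigh quotient *)

Section SignedPower.
Variable R : realType.
Implicit Types (a x y p : R).

Lemma norm_powR_continuous a : 0 < a -> continuous (fun x : R => `|x| `^ a).
Proof.
move=> a0 x; have [->|x0] := eqVneq x 0.
  rewrite /continuous_at normr0 powR0 ?gt_eqF //; apply/cvgrPdist_lt => e e0.
  have ea0 : 0 < e `^ a^-1 by exact: powR_gt0.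
  apply/nbhs_ballP; exists (e `^ a^-1) => // y.
  rewrite /= !sub0r !normrN => hy; rewrite ger0_norm ?powR_ge0 //.
  rewrite -[X in _ < X](powRr1 (ltW e0)) -(mulVf (negbT (gt_eqF a0))) powRrM.
  by rewrite gt0_ltr_powR ?nnegrE ?powR_ge0.
apply: (@continuous_comp R R R Num.norm (fun y : R => y `^ a)).
  exact: norm_continuous.
apply: differentiable_continuous; apply/derivable1_diffP.
by apply: derivable_powR; rewrite in_itv /= andbT normr_gt0.
Qed.

(* [sgn(x) |x|^a], written so that its continuity at [0] is immediate. *)
Definition spow a x : R := `|(`|x| + x) / 2| `^ a - `|(`|x| - x) / 2| `^ a.

Lemma spow_continuous a : 0 < a -> continuous (spow a).
Proof.
move=> a0 x; apply: cvgB.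
  apply: (@continuous_comp R R R (fun y : R => (`|y| + y) / 2) (fun y => `|y| `^ a)).
    by apply: cvgMr_tmp; apply: cvgD; [exact: norm_continuous|exact: cvg_id].
  exact: norm_powR_continuous.
apply: (@continuous_comp R R R (fun y : R => (`|y| - y) / 2) (fun y => `|y| `^ a)).
  by apply: cvgMr_tmp; apply: cvgB; [exact: norm_continuous|exact: cvg_id].
exact: norm_powR_continuous.
Qed.

Lemma spowN a x : spow a (- x) = - spow a x.
Proof. by rewrite /spow normrN opprK opprB. Qed.

Lemma spow_ge0 a x : 0 < a -> 0 <= x -> spow a x = x `^ a.
Proof.
move=> a0 x0; rewrite /spow (ger0_norm x0) subrr mul0r normr0 powR0 ?gt_eqF //.
by rewrite subr0 -mulr2n -[x *+ 2]mulr_natr mulfK // ger0_norm.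
Qed.

Lemma spow_sqr p x : 0 < p -> spow (p / 2) x ^+ 2 = `|x| `^ p.
Proof.
move=> p0; have p2 : 0 < p / 2 by rewrite divr_gt0.
wlog x0 : x / 0 <= x => [h|].
  have [|/ltW] := leP 0 x; first exact: h.
  by rewrite -oppr_ge0 => /h; rewrite spowN sqrrN normrN.
rewrite spow_ge0 // ger0_norm // expr2 -powRM // -expr2 -powR_mulrn //.
by rewrite -powRrM mulrC divfK.
Qed.

(** Up to a common sign [x >= 0]. For negative [y] the left side is at most 0; otherwise raise
    [4xy <= (x + y)^2] to the power [p / 2]. *)
Lemma spow_mul_le p x y : 0 < p ->
  2 `^ p * (spow (p / 2) x * spow (p / 2) y) <= `|x + y| `^ p.
Proof.
move=> p0; have p2 : 0 < p / 2 by rewrite divr_gt0.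
wlog x0 : x y / 0 <= x => [h|].
  have [|/ltW] := leP 0 x; first exact: h.
  by rewrite -oppr_ge0 => /(h _ (- y)); rewrite !spowN mulrNN -opprD normrN.
have [y0|y0] := leP 0 y; last first.
  have sy : spow (p / 2) y <= 0.
    by rewrite -oppr_ge0 -spowN spow_ge0 ?powR_ge0 // oppr_ge0 ltW.
  apply: le_trans (powR_ge0 _ _); rewrite pmulr_rle0 ?powR_gt0 //.
  by rewrite mulr_ge0_le0 // spow_ge0 // powR_ge0.
rewrite !spow_ge0 // -powRM // ger0_norm ?addr_ge0 //.
have sq (z : R) : 0 <= z -> z `^ p = (z ^+ 2) `^ (p / 2).
  by move=> z0; rewrite -powR_mulrn // -powRrM mulrC divfK.
rewrite (sq 2) // (sq (x + y)) ?addr_ge0 // -powRM ?mulr_ge0 ?exprn_ge0 //.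
apply: ge0_ler_powR; rewrite ?nnegrE ?(ltW p2) ?mulr_ge0 ?exprn_ge0 ?addr_ge0 //.
by rewrite -subr_ge0 (_ : _ - _ = (x - y) ^+ 2) ?sqr_ge0 //; ring.
Qed.

End SignedPower.

Lemma rV_continuous (R : realType) (T : topologicalType) m (h : T -> 'rV[R]_m) x :
  (forall k, {for x, continuous (fun y => h y ord0 k)}) -> {for x, continuous h}.
Proof.
move=> hk; apply/cvgrPdist_lt => e e0.
have : \forall y \near x, forall k, `|h x ord0 k - h y ord0 k| < e.
  by apply: filter_forall => k; have /cvgrPdist_lt := hk k; exact.
apply: filterS => y hy; rewrite /Num.norm /= mx_normrE; apply: bigmax_lt => //.
by move=> -[i k] _ /=; rewrite (ord1 i) !mxE.
Qed.

(** * Bounds for the p-Rayleigh quotient on the unit sphere *)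

Section RayleighBound.
Variables (R : realType) (n : nat) (adj : rel 'I_n) (sg w : 'I_n -> 'I_n -> R).
Variables (mu kap : 'I_n -> R) (p : R).
Hypothesis G : signed_graph adj sg w mu kap.
Hypothesis p1 : 1 <= p.
Implicit Types f : 'rV[R]_n.

Let p0 : 0 < p. Proof. exact: lt_le_trans p1. Qed.

Definition rspow f : 'rV[R]_n := \row_i spow (p / 2) (f ord0 i).

Lemma mass_rspow f : mass mu (rspow f) = \sum_(i < n) mu i * `|f ord0 i| `^ p.
Proof. by apply: eq_bigr => i _; rewrite mxE spow_sqr. Qed.

(** This factor 2 turns [2 ^ (p - 1)] into the [2 ^ p] of the AM-GM inequality. *)
Lemma edge_form_double (E0 : rel 'I_n) (g : 'rV[R]_n) :
  (forall i j, E0 i j -> [/\ E0 j i, i != j, sg i j = sg j i & w i j = w j i]) ->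
  edge_form sg w E0 g = 2 * \sum_(i < n) \sum_(j < n | (i < j)%N && E0 i j)
    - sg i j * w i j * g ord0 i * g ord0 j.
Proof.
move=> hE; rewrite mulr2n mulrDl mul1r /edge_form.
rewrite [X in _ = _ + X](exchange_big_dep xpredT) //= -big_split /=; apply: eq_bigr => i _.
rewrite (bigID (fun j : 'I_n => (i < j)%N)) /=; congr (_ + _).
  by apply: eq_bigl => j; rewrite andbC.
apply: eq_big => [j|j /andP[/hE[_ _ -> ->] _]]; last by ring.
rewrite -leqNgt leq_eqVlt; case Eij: (E0 i j) => /=.
  have [-> ij _ _] := hE _ _ Eij; rewrite andbT.
  by rewrite (_ : (j == i :> nat) = false) //; apply/negbTE; rewrite eq_sym.
by apply/esym/negP => /andP[_ /hE[]]; rewrite Eij.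
Qed.

(** Edges in [E0] are bounded by AM-GM applied to [f_i] and [- sg i j * f_j], other edges contribute
    at least 0, and the potential term is at least minus the maximum times the mass, which is 1. *)
Lemma rayleigh_lower_bound (V0 : {set 'I_n}) (E0 : rel 'I_n) f :
  subgraph adj V0 E0 -> Sp mu p f ->
  2 `^ (p - 1) * edge_form sg w E0 (rspow f)
    - \big[Num.max/0]_(i < n) `|kap i / mu i| <= rayleigh_p adj sg w mu kap p f.
Proof.
case: G => irr sym hs hw mu0 [E0s E0a] fS; rewrite /rayleigh_p fS divr1.
apply: lerD.
  rewrite edge_form_double => [|i j Eij]; last first.
    have /andP[/andP[/[dup] aij]] := E0a _ _ Eij; rewrite -E0s Eij => aij' _ _.
    have [-> _] := hs _ _ aij; have [-> _] := hw _ _ aij; split=> //.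
    by apply: contraTneq aij => ->; exact: irr.
  rewrite mulrA (mulrC _ 2) mulr_powRB1 //.
  rewrite mulr_sumr; apply: ler_sum => i _; rewrite mulr_sumr.
  rewrite big_mkcond [leRHS]big_mkcond; apply: ler_sum => j _.
  have [ij|//] := boolP (i < j)%N; rewrite /=.
  case Eij: (E0 i j).
    have /andP[/andP[aij _] _] := E0a _ _ Eij; rewrite aij.
    have [_ s1] := hs _ _ aij; have [_ w0] := hw _ _ aij.
    have := spow_mul_le (f ord0 i) (- sg i j * f ord0 j) p0.
    rewrite mulNr => /(ler_wpM2l (ltW w0)) h; apply: le_trans h.
    have -> : spow (p / 2) (- (sg i j * f ord0 j)) = - sg i j * rspow f ord0 j.
      by rewrite mxE spowN; case: s1 => ->; rewrite ?mul1r ?mulN1r ?spowN ?opprK ?mul1r ?mulN1r.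
    by rewrite mxE le_eqVlt; apply/orP; left; apply/eqP; ring.
  case: ifP => // aij; have [_ w0] := hw _ _ aij.
  by rewrite mulr_ge0 ?powR_ge0 // ltW.
set C := \big[_/_]_(_ < _) _.
rewrite -[C]mulr1 -fS mulr_sumr -sumrN; apply: ler_sum => i _.
rewrite mulrA -mulNr ler_wpM2r ?powR_ge0 // lerNl -ler_pdivrMr //.
apply: (@le_trans _ _ `|kap i / mu i|).
  by rewrite mulNr -normrN ler_norm.
by rewrite /C (bigD1 i) //= le_max lexx.
Qed.

(** Makes [sup] in [lambda_p] a genuine upper bound rather than a default value; on the sphere each
    [|f_i|^p] is at most [(mu i)^-1]. *)
Lemma rayleigh_bounded : has_ubound (rayleigh_p adj sg w mu kap p @` Sp mu p).
Proof.
case: G => irr sym hs hw mu0.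
exists (\sum_(i < n) \sum_(j < n | (i < j)%N && adj i j)
      w i j * (2 `^ p * ((mu i)^-1 + (mu j)^-1)) + \sum_(i < n) `|kap i| * (mu i)^-1).
have h i f : Sp mu p f -> `|f ord0 i| `^ p <= (mu i)^-1.
  move=> fS; rewrite -[leRHS]mul1r ler_pdivlMr // -fS (bigD1 i) //= mulrC lerDl.
  by rewrite sumr_ge0 // => j _; rewrite mulr_ge0 ?powR_ge0 // ltW.
have mono (x y : R) : 0 <= x -> x <= y -> x `^ p <= y `^ p.
  move=> x0 xy; rewrite ge0_ler_powR ?nnegrE ?(ltW p0) //.
  exact: le_trans xy.
move=> _ [f fS <-]; rewrite /rayleigh_p fS divr1; apply: lerD; last first.
  apply: ler_sum => i _; apply: (le_trans (ler_norm _)).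
  by rewrite normrM ler_wpM2l // ger0_norm ?powR_ge0 // h.
apply: ler_sum => i _; apply: ler_sum => j /andP[_ aij].
have [_ w0] := hw _ _ aij; have [_ s1] := hs _ _ aij.
rewrite ler_wpM2l ?(ltW w0) //.
pose M := Num.max `|f ord0 i| `|f ord0 j|.
have M0 : 0 <= M by rewrite le_max normr_ge0.
apply: (@le_trans _ _ ((2 * M) `^ p)).
  apply: mono => //; apply: (le_trans (ler_normB _ _)).
  have -> : `|sg i j * f ord0 j| = `|f ord0 j|.
    by rewrite normrM; case: s1 => ->; rewrite ?normrN normr1 mul1r.
  by rewrite mulr2n mulrDl mul1r lerD // le_max lexx ?orbT.
rewrite powRM // ler_wpM2l ?powR_ge0 // /M.
have hi := h i _ fS; have hj := h j _ fS.
rewrite /Num.max; case: ifP => _.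
  by rewrite (le_trans hj) // lerDr invr_ge0 ltW.
by rewrite (le_trans hi) // lerDl invr_ge0 ltW.
Qed.

End RayleighBound.

(** * Genus of the unit sphere and the main estimate *)

Section Genus.
Variables (R : realType) (n : nat) (mu : 'I_n -> R) (p : R).
Hypothesis mu_gt0 : forall i, 0 < mu i.
Hypothesis p_gt0 : 0 < p.
Implicit Types f x : 'rV[R]_n.

Definition massp f : R := \sum_(i < n) mu i * `|f ord0 i| `^ p.

Lemma masspN f : massp (- f) = massp f.
Proof. by apply: eq_bigr => i _; rewrite mxE normrN. Qed.

Lemma massp0 : massp 0 = 0.
Proof.
by rewrite /massp big1 // => i _; rewrite mxE normr0 powR0 ?gt_eqF ?mulr0.
Qed.

Lemma massp_continuous : continuous massp.
Proof.
apply: continuous_sumr => i x.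
apply: (@entry_continuous _ _ _ id i (fun t => `|t| `^ p)).
  exact: cvg_id.
exact: norm_powR_continuous.
Qed.

Lemma massp_gt0 f : f != 0 -> 0 < massp f.
Proof.
move=> /rV0Pn[i fi]; rewrite /massp (bigD1 i) //= ltr_wpDr //.
  by rewrite sumr_ge0 // => l _; rewrite mulr_ge0 ?powR_ge0 // ltW.
by rewrite mulr_gt0 // powR_gt0 // normr_gt0.
Qed.

(** Radial projection onto the sphere, [massp] being homogeneous of degree [p]. *)
Definition unit_massp f : 'rV[R]_n := (`|massp f| `^ p^-1)^-1 *: f.

Lemma unit_masspN f : unit_massp (- f) = - unit_massp f.
Proof. by rewrite /unit_massp masspN scalerN. Qed.

Lemma unit_massp_Sp f : f != 0 -> Sp mu p (unit_massp f).
Proof.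
move=> f0; have m0 := massp_gt0 f0.
have N0 : 0 < (`|massp f| `^ p^-1)^-1 by rewrite invr_gt0 powR_gt0 // normr_gt0 gt_eqF.
rewrite /Sp /= (eq_bigr (fun i => (massp f)^-1 * (mu i * `|f ord0 i| `^ p))).
  by rewrite -mulr_sumr mulVf // gt_eqF.
move=> i _; rewrite mxE normrM (gtr0_norm N0) powRM ?(ltW N0) // mulrCA; congr (_ * _).
rewrite -powR_inv1 ?powR_ge0 // -!powRrM.
have -> : p^-1 * (-1 * p) = -1 by rewrite mulN1r mulrN mulVf ?gt_eqF.
by rewrite powR_inv1 // gtr0_norm.
Qed.

Lemma unit_massp_continuous f : f != 0 -> {for f, continuous unit_massp}.
Proof.
move=> f0; have m0 := massp_gt0 f0.
apply: rV_continuous => k.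
have -> : (fun y => unit_massp y ord0 k) =
    (fun y => (`|massp y| `^ p^-1)^-1 * y ord0 k).
  by apply/funext => y; rewrite mxE.
apply: (@continuousM R _ (fun y => (`|massp y| `^ p^-1)^-1) (fun y => y ord0 k)).
  2: exact: coord_continuous.
apply: (@continuousV R _ (fun y => `|massp y| `^ p^-1)).
  by rewrite gt_eqF // powR_gt0 // normr_gt0 gt_eqF.
apply: (@continuous_comp _ R R massp (fun t : R => `|t| `^ p^-1)).
  exact: massp_continuous.
by apply: norm_powR_continuous; rewrite invr_gt0.
Qed.

(** Composed with the radial projection, an odd map on the sphere becomes odd and continuous away
    from 0, where Borsuk-Ulam supplies a zero. *)
Lemma genus_Sp k : (k <= n)%N -> genus_ge (Sp mu p) k.
Proof.
move=> kn j jk [g [gc gN g0]].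
have hc x : x != 0 -> {for x, continuous (g \o unit_massp)}.
  move=> x0; move/subspace_continuousP : gc => /(_ _ (unit_massp_Sp x0)) gx.
  apply: cvg_trans gx => A /= gA.
  have /= := unit_massp_continuous x0 gA.
  (* [g] is continuous only relative to the sphere; points near [x] are nonzero and hence project
     into it. *)
  have : \forall t \near x, 0 < massp t.
    have mc : {for x, continuous massp} by exact: massp_continuous.
    by apply: (cvgr_gt (massp x)) mc _ _; exact: massp_gt0.
  apply: filterS2 => t mt gt; apply: gt; apply: unit_massp_Sp.
  by apply: contraTneq mt => ->; rewrite massp0 ltxx.
have hN x : x != 0 -> (g \o unit_massp) (- x) = - (g \o unit_massp) x.
  by move=> x0; rewrite /= unit_masspN gN //; exact: unit_massp_Sp.
have [x x0 gx] := borsuk_ulam (leq_trans jk kn) hc hN.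
move: (g0 _ (unit_massp_Sp x0)).
by rewrite -[g _]/((g \o unit_massp) x) gx eqxx.
Qed.

Lemma Sp_Fk k : (k <= n)%N -> Fk mu p k (Sp mu p).
Proof.
move=> kn; split=> //; last exact: genus_Sp.
- rewrite (_ : Sp mu p = massp @^-1` [set 1]) //.
  by apply: preimage_closed => [x _|]; [exact: massp_continuous|exact: closed_eq].
- by move=> x; rewrite /Sp /= -!/(massp _) masspN.
Qed.

End Genus.

Lemma Fk_lower_bound (R : realType) n (adj : rel 'I_n) (sg w : 'I_n -> 'I_n -> R)
  (mu kap : 'I_n -> R) (p : R) k (E0 : rel 'I_n) (B : set 'rV[R]_n) :
  signed_graph adj sg w mu kap -> 1 <= p -> (0 < k <= n)%N ->
  subgraph adj [set: 'I_n]%SET E0 -> Fk mu p k B ->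
  2 `^ (p - 1) * eigval (Amu_neg sg w mu [set: 'I_n]%SET E0) k
    - \big[Num.max/0]_(i < n) `|kap i / mu i|
  <= sup (rayleigh_p adj sg w mu kap p @` B).
Proof.
move=> G p1 hk E0P [Bcl BN BS Bg]; have p0 : 0 < p by exact: lt_le_trans p1.
have [irr sym hs hw mu0] := G; have [E0s E0a] := E0P.
have hE i j : E0 i j -> [/\ E0 j i, i \in [set: 'I_n]%SET, j \in [set: 'I_n]%SET,
    sg i j = sg j i & w i j = w j i].
  move=> Eij; have /andP[/andP[aij _] _] := E0a _ _ Eij.
  by have [-> _] := hs _ _ aij; have [-> _] := hw _ _ aij; rewrite -E0s Eij !inE.
have hkT : (0 < k <= #|[set: 'I_n]%SET|)%N by rewrite cardsT card_ord.
have [W [d [qW mW cW _]]] := subgraph_spectrum mu0 hE hkT.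
set x := eigval _ k in cW *.
pose P := [pred a | d ord0 a < x].
pose M : 'M[R]_(_, #|P|) := \matrix_(a, b) W a (enum_val b).
(* The eigencoordinates with eigenvalue below [x]. There are fewer than [k] of them, so the genus of
   [B] forces this odd map to vanish somewhere on [B]. *)
pose g f : 'rV[R]_#|P| := restr [set: 'I_n]%SET (rspow p f) *m M.
have [f Bf gf] : exists2 f, B f & g f = 0.
  apply: contrapT => noz; apply: (Bg _ cW); exists g; split.
  - apply: continuous_subspaceT => f; apply: rV_continuous => b.
    have -> : (fun y => g y ord0 b) =
        (fun y : 'rV[R]_n => \sum_a M a b * spow (p / 2) (y ord0 (enum_val a))).
      apply/funext => y; rewrite mxE; apply: eq_bigr => a _.
      by rewrite mulrC; congr (_ * _); rewrite !mxE.
    apply: continuous_sumr => a y.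
    apply: (@entry_continuous _ _ _ id (enum_val a)); first exact: cvg_id.
    by apply: spow_continuous; rewrite divr_gt0.
  - move=> f _; rewrite /g -mulNmx; congr (_ *m _).
    by apply/rowP => a; rewrite !mxE spowN.
  - by move=> f Bf; apply/eqP => gf; apply: noz; exists f.
have fS := BS _ Bf.
apply: (@le_trans _ _ (rayleigh_p adj sg w mu kap p f)); last first.
  apply: ub_le_sup; last by exists f.
  have [u ub] := rayleigh_bounded G p1.
  by exists u => _ [h Bh <-]; apply: ub; exists h => //; exact: BS.
apply: le_trans (rayleigh_lower_bound G p1 E0P fS).
rewrite lerD2r ler_wpM2l ?powR_ge0 //.
have m1 : mass mu (rspow p f) = 1 by rewrite mass_rspow.
rewrite -[leLHS]mulr1 -m1 mW => [|i]; last by rewrite inE.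
rewrite qW mulr_sumr; apply: ler_sum => a _.
have [ax|ax] := leP x (d ord0 a); first by rewrite ler_wpM2r ?sqr_ge0.
have aP : a \in P by rewrite inE.
have <- : g f ord0 (enum_rank_in aP a) =
    (restr [set: 'I_n]%SET (rspow p f) *m W) ord0 a.
  by rewrite mxE [RHS]mxE; apply: eq_bigr => b _; rewrite [M _ _]mxE enum_rankK_in.
by rewrite gf mxE expr0n !mulr0.
Qed.

(** * The lower bound and the reduction to spanning subgraphs *)

Unset Implicit Arguments.

Theorem theorem5p4 (R : realType) (n : nat) (adj : rel 'I_n)
  (sg w : 'I_n -> 'I_n -> R) (mu kap : 'I_n -> R) (p : R) (k : nat) :
  signed_graph adj sg w mu kap ->
  1 <= p -> (1 <= k)%N -> (k <= n)%N ->
  let C : R := \big[Num.max/0]_(i < n) `|kap i / mu i| in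
  let M1 : R := sup [set x : R | exists (V0 : {set 'I_n}) (E0 : rel 'I_n),
                  [/\ subgraph adj V0 E0, (n - k + 1 <= #|V0|)%N &
                      x = eigval (Amu_neg sg w mu V0 E0) (#|V0| + k - n)%N]] in
  let M2 : R := sup [set x : R | exists (V0 : {set 'I_n}) (E0 : rel 'I_n),
                  [/\ subgraph adj V0 E0, #|V0| = n &
                      x = eigval (Amu_neg sg w mu V0 E0) k]] in
  lambda_p adj sg w mu kap p k >= powR 2 (p - 1) * M1 - C /\
  powR 2 (p - 1) * M1 - C = powR 2 (p - 1) * M2 - C.
Proof.
move=> G p1 k0 kn C M1 M2; have [irr sym hs hw mu0] := G.
have p0 : 0 < p by exact: lt_le_trans p1.
have hk : (0 < k <= n)%N by rewrite k0.
have t0 : 0 < 2 `^ (p - 1) by rewrite powR_gt0.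
have Tn : #|[set: 'I_n]%SET| = n by rewrite cardsT card_ord.
rewrite {}/M1 {}/M2; set S1 := (X in _ * sup X - C <= _).
set S2 := (X in _ = _ * sup X - C).
have S2E x : S2 x -> exists2 E0, subgraph adj [set: 'I_n]%SET E0 &
    x = eigval (Amu_neg sg w mu [set: 'I_n]%SET E0) k.
  move=> [V0 [E0 [sE cV ->]]]; have VT : V0 = [set: 'I_n]%SET.
    by apply/eqP; rewrite eqEcard finset.subsetT Tn cV leqnn.
  by rewrite VT in sE *; exists E0.
have S2i E0 : subgraph adj [set: 'I_n]%SET E0 ->
    S2 (eigval (Amu_neg sg w mu [set: 'I_n]%SET E0) k).
  by move=> sE; exists [set: 'I_n]%SET, E0.
have S21 x : S2 x -> S1 x.
  move=> /S2E[E0 sE ->]; exists [set: 'I_n]%SET, E0; split=> //.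
    by rewrite Tn addn1 ltn_subrL k0 (leq_trans k0 kn).
  by congr eigval; rewrite Tn addnC addnK.
(* The same edges on all of [V] give a spanning subgraph, whose eigenvalue is at least as large by
   interlacing. *)
have S12 x : S1 x -> exists2 y, S2 y & x <= y.
  move=> [V0 [E0 [[Es Ea] cV ->]]].
  exists (eigval (Amu_neg sg w mu [set: 'I_n]%SET E0) k).
    apply: S2i; split=> // i j /Ea /andP[/andP[-> _] _]; by rewrite !inE.
  apply: eigval_interlacing => //.
    move=> i j Eij; have /andP[/andP[aij -> ->]] := Ea _ _ Eij.
    by have [-> _] := hs _ _ aij; have [-> _] := hw _ _ aij; rewrite -Es Eij.
  by move: cV; rewrite addn1 ltn_subLR // addnC.
have bound x : S2 x -> 2 `^ (p - 1) * x - C <= lambda_p adj sg w mu kap p k.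
  move=> /S2E[E0 sE ->]; apply: lb_le_inf.
    exists (sup (rayleigh_p adj sg w mu kap p @` Sp mu p)), (Sp mu p) => //.
    exact: Sp_Fk.
  by move=> _ [B FB <-]; exact: Fk_lower_bound.
(* The estimate itself supplies the upper bound that makes both suprema genuine. *)
have ub2 : ubound S2 ((lambda_p adj sg w mu kap p k + C) / 2 `^ (p - 1)).
  by move=> x /bound; rewrite lerBlDr mulrC -ler_pdivlMr.
(* The edgeless spanning subgraph is a member. *)
have ne2 : S2 !=set0.
  eexists; apply: (S2i (fun _ _ => false)); by split.
have ne1 : S1 !=set0 by have [x /S21] := ne2; exists x.
have ub1 : ubound S1 ((lambda_p adj sg w mu kap p k + C) / 2 `^ (p - 1)).
  by move=> x /S12[y /ub2 + /le_trans]; move=> /[swap]; apply.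
have M12 : sup S1 = sup S2.
  apply/eqP; rewrite eq_le; apply/andP; split.
    apply: ge_sup => // x /S12[y S2y xy]; apply: (le_trans xy).
    by apply: ub_le_sup => //; exists ((lambda_p adj sg w mu kap p k + C) / 2 `^ (p - 1)).
  apply: ge_sup => // x /S21 S1x.
  by apply: ub_le_sup => //; exists ((lambda_p adj sg w mu kap p k + C) / 2 `^ (p - 1)).
split; last by rewrite M12.
by rewrite lerBlDr mulrC -ler_pdivlMr //; exact: ge_sup.
Qed.
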